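(* Let $\varphi$ be a quantifier-free formula of the extensional theory of arrays (with the index sort $I$ interpreted over infinite domains), and let $a$ be a variable of array sort $\mathrm{Arr}(I,V)$. Then $\textsc{ArrayQE}(\exists a\cdot\varphi)$ terminates in time exponential in the size of $\varphi$.
   Context: Setting: a many-sorted first-order language with equality whose sorts are basic sorts and array sorts $\mathrm{Arr}(I,V)$, with $I$ a basic sort of indices and $V$ a sort of values. For each array sort there are function symbols $\mathit{rd}:\mathrm{Arr}(I,V)\times I\to V$ and $\mathit{wr}:\mathrm{Arr}(I,V)\times I\times V\to\mathrm{Arr}(I,V)$, and no other symbols. The theory of arrays is axiomatized by read-after-write and extensionality. Standing assumption: the index sort $I$ is interpreted over infinite domains. For a vector $\vec{i}$ of index terms, $j\in\vec{i}$ abbreviates $\bigvee_k j=\vec{i}(k)$; $\mathit{wr}(a,\vec{i},\vec{v})$ denotes the iterated write; the partial equality $a=_{\vec{i}}b$ abbreviates $\forall j:I\cdot(j\notin\vec{i}\Rightarrow\mathit{rd}(a,j)=\mathit{rd}(b,j))$. $\varphi[t]$ denotes a formula with an occurrence of $t$ at some position. $\textsc{ArrayQE}(\exists a\cdot\varphi)$ is the following procedure. Step 1: apply to a fixed point (nondeterministically chosen): (ElimWrRd) $\varphi[\mathit{rd}(\mathit{wr}(t,i,v),j)]\leadsto(i=j\wedge\varphi[v])\vee(i\neq j\wedge\varphi[\mathit{rd}(t,j)])$; (ElimWrEq) $\varphi[\mathit{wr}(t_1,j,v)=_{\vec{i}}t_2]\leadsto(j\in\vec{i}\wedge\varphi[t_1=_{\vec{i}}t_2])\vee(j\notin\vec{i}\wedge\varphi[t_1=_{\vec{i},j}t_2\wedge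 v=\mathit{rd}(t_2,j)])$; (PartialEq) $\varphi[t_1=t_2]\leadsto\varphi[t_1=_{\emptyset}t_2]$ for array-sorted $t_1,t_2$; (TrivEq) $\varphi[t=_{\vec{i}}t]\leadsto\varphi[\top]$; (Symm) $\varphi[t_1=_{\vec{i}}t_2]\leadsto\varphi[t_2=_{\vec{i}}t_1]$ when $t_2$ is a write term and $t_1$ is not. Step 2: for each partial equality on $a$, exactly once, (CaseSplitEq) $\exists a\cdot\varphi[a=_{\vec{i}}t]\leadsto\exists a\cdot((a=_{\vec{i}}t\wedge\varphi[\top])\vee(\neg(a=_{\vec{i}}t)\wedge\varphi[\bot]))$; then for each read term over $a$, exactly once, (FactorRd) $\exists a\cdot\varphi[\mathit{rd}(a,t)]\leadsto\exists a,s\cdot(\varphi[s]\wedge s=\mathit{rd}(a,t))$ with $s$ fresh and $t$ without array terms. Step 3 (LiftEqDiseqRd): Boolean rewriting to an equivalent disjunction $\bigvee_{k=1}^n\delta_k$, each disjunct ending with conjuncts consisting of partial equalities on $a$, then array disequalities, then equalities over read terms on $a$. Step 4: for each $\delta_k$ apply (ElimEq) $\exists a\cdot(a=_{\vec{i}}t\wedge\varphi)\leadsto\exists\vec{v}\cdot\varphi[\mathit{wr}(t,\vec{i},\vec{v})/a]$ ($a$ not in $t$, $\vec{v}$ fresh); then (ElimDiseq) $\exists a\cdot(\varphi\wedge\bigwedge_k\neg(a=_{\vec{i}_k}t_k))\leadsto\exists a\cdot\varphi$ ($a$ not in the $t_k$, and occurring in $\varphi$ only in read terms); then (Ackermann)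 $\exists a\cdot(\varphi\wedge\bigwedge_{k=1}^m s_k=\mathit{rd}(a,t_k))\leadsto\varphi\wedge\bigwedge_{k<\ell}(t_k=t_\ell\Rightarrow s_k=s_\ell)$ ($a$ not in $\varphi$, $s_k$, $t_k$), obtaining $\psi_k$; return $\bigvee_k\psi_k$.
   Formalization: Each rule rewrites one disjunct at a time and replaces all occurrences of t in φ[t], since rewriting single occurrences or the whole disjunction may not terminate or be doubly exponential; FactorRd's ''t without array terms'' is read as ''t does not contain a''; Step 3 only permutes conjuncts. *)

(* Defs.v *)
From HB Require Import structures.
From mathcomp Require Import all_boot.

Set Implicit Arguments.
Unset Strict Implicit.
Unset Printing Implicit Defensive.

(** * Sorts, terms and formulas *)

Inductive sortT (B : Type) : Type :=
| Basic of B
| Arr of B & sortT B.   (* Arr I V: indices of basic sort I, values of sort V *)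
Arguments Basic {B}.
Arguments Arr {B}.

Section SortEq.
Variable B : eqType.

Fixpoint sort_eqb (s t : sortT B) : bool :=
  match s, t with
  | Basic b, Basic c => b == c
  | Arr b s', Arr c t' => (b == c) && sort_eqb s' t'
  | _, _ => false
  end.

Lemma sort_eqP : Equality.axiom sort_eqb.
Proof.
elim=> [b|b s IH] [c|c t] /=; try by constructor.
  by apply: (iffP eqP) => [->|[]].
apply: (iffP andP) => [[/eqP-> /IH->]|[<- <-]] //; split=> //; exact/IH.
Qed.

HB.instance Definition _ := hasDecEq.Build (sortT B) sort_eqP.
End SortEq.

(* A variable carries its sort. *)
Definition var (B : Type) : Type := (nat * sortT B)%type.

Inductive term (B : Type) : Type :=
| Var of var B
| Rd of term B & term B
| Wr of term B & term B & term B.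
Arguments Var {B}.
Arguments Rd {B}.
Arguments Wr {B}.

Section TermEq.
Variable B : eqType.

Fixpoint term_eqb (t u : term B) : bool :=
  match t, u with
  | Var x, Var y => (x : nat * sortT B) == y
  | Rd t1 t2, Rd u1 u2 => term_eqb t1 u1 && term_eqb t2 u2
  | Wr t1 t2 t3, Wr u1 u2 u3 =>
      [&& term_eqb t1 u1, term_eqb t2 u2 & term_eqb t3 u3]
  | _, _ => false
  end.

Lemma term_eqP : Equality.axiom term_eqb.
Proof.
elim=> [x|t1 IH1 t2 IH2|t1 IH1 t2 IH2 t3 IH3] [y|u1 u2|u1 u2 u3] /=;
  try by constructor.
- by apply: (iffP eqP) => [->|[]].
- apply: (iffP andP) => [[/IH1-> /IH2->]|[<- <-]] //.
  by split; [exact/IH1|exact/IH2].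
- apply: (iffP and3P) => [[/IH1-> /IH2-> /IH3->]|[<- <- <-]] //.
  by split; [exact/IH1|exact/IH2|exact/IH3].
Qed.

HB.instance Definition _ := hasDecEq.Build (term B) term_eqP.
End TermEq.

(* [PEq t is u] is the partial equality "t and u agree outside the indices
   is". It abbreviates the quantified formula
     forall j, j \notin is -> rd(t,j) = rd(u,j)
   and so is not part of the quantifier-free fragment (see [qfree]); the
   procedure below manipulates it as an atom. *)
Inductive form (B : Type) : Type :=
| Top
| Bot
| Eq of term B & term B
| PEq of term B & seq (term B) & term B
| Not of form B
| And of form B & form B
| Or of form B & form B
| Imp of form B & form B.
Arguments Top {B}.
Arguments Bot {B}.
Arguments Eq {B}.
Arguments PEq {B}.
Arguments Not {B}.
Arguments And {B}.
Arguments Or {B}.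
Arguments Imp {B}.

Section FormEq.
Variable B : eqType.

Fixpoint form_eqb (f g : form B) : bool :=
  match f, g with
  | Top, Top | Bot, Bot => true
  | Eq t u, Eq t' u' => (t == t') && (u == u')
  | PEq t s u, PEq t' s' u' => [&& t == t', s == s' & u == u']
  | Not f1, Not g1 => form_eqb f1 g1
  | And f1 f2, And g1 g2 | Or f1 f2, Or g1 g2 | Imp f1 f2, Imp g1 g2 =>
      form_eqb f1 g1 && form_eqb f2 g2
  | _, _ => false
  end.

Lemma form_eqP : Equality.axiom form_eqb.
Proof.
elim=> [||t u|t s u|f1 IH1|f1 IH1 f2 IH2|f1 IH1 f2 IH2|f1 IH1 f2 IH2]
  [||t' u'|t' s' u'|g1|g1 g2|g1 g2|g1 g2] /=; try by constructor.
- by apply: (iffP andP) => [[/eqP-> /eqP->]|[-> ->]].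
- by apply: (iffP and3P) => [[/eqP-> /eqP-> /eqP->]|[-> -> ->]].
- by apply: (iffP (IH1 _)) => [->|[]].
- by apply: (iffP andP) => [[/IH1-> /IH2->]|[<- <-]] //;
    split; [exact/IH1|exact/IH2].
- by apply: (iffP andP) => [[/IH1-> /IH2->]|[<- <-]] //;
    split; [exact/IH1|exact/IH2].
- by apply: (iffP andP) => [[/IH1-> /IH2->]|[<- <-]] //;
    split; [exact/IH1|exact/IH2].
Qed.

HB.instance Definition _ := hasDecEq.Build (form B) form_eqP.
End FormEq.

Section Syntax.
Variable B : eqType.
Implicit Types (t u R S : term B) (f g E : form B) (a x : var B).

Fixpoint sort_of t : option (sortT B) :=
  match t with
  | Var x => Some x.2
  | Rd t i =>
      match sort_of t, sort_of i with
      | Some (Arr b V), Some s => if s == Basic b then Some V else None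
      | _, _ => None
      end
  | Wr t i v =>
      match sort_of t, sort_of i, sort_of v with
      | Some (Arr b V), Some s, Some s' =>
          if (s == Basic b) && (s' == V) then Some (Arr b V) else None
      | _, _, _ => None
      end
  end.

Definition is_arr (s : option (sortT B)) : bool :=
  if s is Some (Arr _ _) then true else false.

Definition is_wr t : bool := if t is Wr _ _ _ then true else false.

Fixpoint well_sorted f : bool :=
  match f with
  | Top | Bot => true
  | Eq t u => (sort_of t != None) && (sort_of t == sort_of u)
  | PEq t s u =>
      if sort_of t is Some (Arr b V) then
        (sort_of u == Some (Arr b V)) &&
        all (fun i => sort_of i == Some (Basic b)) s
      else false
  | Not f => well_sorted f
  | And f g | Or f g | Imp f g => well_sorted f && well_sorted g
  end.

Fixpoint qfree f : bool :=
  match f with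
  | Top | Bot | Eq _ _ => true
  | PEq _ _ _ => false
  | Not f => qfree f
  | And f g | Or f g | Imp f g => qfree f && qfree g
  end.

(* Sizes count symbols. *)
Fixpoint tsize t : nat :=
  match t with
  | Var _ => 1
  | Rd t i => (tsize t + tsize i).+1
  | Wr t i v => (tsize t + tsize i + tsize v).+1
  end.

Fixpoint fsize f : nat :=
  match f with
  | Top | Bot => 1
  | Eq t u => (tsize t + tsize u).+1
  | PEq t s u => (tsize t + sumn (map tsize s) + tsize u).+1
  | Not f => (fsize f).+1
  | And f g | Or f g | Imp f g => (fsize f + fsize g).+1
  end.

Fixpoint subterms t : seq (term B) :=
  t :: match t with
       | Var _ => [::]
       | Rd t i => subterms t ++ subterms i
       | Wr t i v => subterms t ++ subterms i ++ subterms v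
       end.

(* All terms with an occurrence in a formula. *)
Fixpoint fterms f : seq (term B) :=
  match f with
  | Top | Bot => [::]
  | Eq t u => subterms t ++ subterms u
  | PEq t s u => subterms t ++ flatten (map subterms s) ++ subterms u
  | Not f => fterms f
  | And f g | Or f g | Imp f g => fterms f ++ fterms g
  end.

Fixpoint atoms f : seq (form B) :=
  match f with
  | Top | Bot => [::]
  | Eq _ _ | PEq _ _ _ => [:: f]
  | Not f => atoms f
  | And f g | Or f g | Imp f g => atoms f ++ atoms g
  end.

(* Replacement of (all occurrences of) the term R by S. *)
Fixpoint tsubst R S t : term B :=
  if t == R then S else
  match t with
  | Var x => Var x
  | Rd t i => Rd (tsubst R S t) (tsubst R S i)
  | Wr t i v => Wr (tsubst R S t) (tsubst R S i) (tsubst R S v)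
  end.

Fixpoint fsubst R S f : form B :=
  match f with
  | Top => Top
  | Bot => Bot
  | Eq t u => Eq (tsubst R S t) (tsubst R S u)
  | PEq t s u => PEq (tsubst R S t) (map (tsubst R S) s) (tsubst R S u)
  | Not f => Not (fsubst R S f)
  | And f g => And (fsubst R S f) (fsubst R S g)
  | Or f g => Or (fsubst R S f) (fsubst R S g)
  | Imp f g => Imp (fsubst R S f) (fsubst R S g)
  end.

(* Replacement of (all occurrences of) the atom E by the formula h. *)
Fixpoint asubst E (h : form B) f : form B :=
  match f with
  | Top => Top
  | Bot => Bot
  | Eq _ _ | PEq _ _ _ => if f == E then h else f
  | Not f => Not (asubst E h f)
  | And f g => And (asubst E h f) (asubst E h g)
  | Or f g => Or (asubst E h f) (asubst E h g)
  | Imp f g => Imp (asubst E h f) (asubst E h g)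
  end.

Definition bigand (s : seq (form B)) : form B := foldr And Top s.
Definition bigor (s : seq (form B)) : form B := foldr Or Bot s.

(* j \in is, as a formula *)
Definition inidx j (s : seq (term B)) : form B :=
  bigor [seq Eq j i | i <- s].

(* Iterated write wr(t, is, vs). *)
Definition wrs t (s : seq (term B)) (vs : seq (var B)) : term B :=
  foldl (fun u p => Wr u p.1 (Var p.2)) t (zip s vs).

Fixpoint conjuncts f : seq (form B) :=
  match f with
  | And f g => conjuncts f ++ conjuncts g
  | _ => [:: f]
  end.

Definition occurs a f : bool := Var a \in fterms f.
Definition toccurs a t : bool := Var a \in subterms t.

(* Every occurrence of a is as the array being read. *)
Fixpoint tonly_read a t : bool :=
  match t with
  | Var x => x != a
  | Rd t i => (if t is Var _ then true else tonly_read a t) && tonly_read a i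
  | Wr t i v => [&& tonly_read a t, tonly_read a i & tonly_read a v]
  end.

Fixpoint only_read a f : bool :=
  match f with
  | Top | Bot => true
  | Eq t u => tonly_read a t && tonly_read a u
  | PEq t s u => [&& tonly_read a t, all (tonly_read a) s & tonly_read a u]
  | Not f => only_read a f
  | And f g | Or f g | Imp f g => only_read a f && only_read a g
  end.

(* [peq_on a e = Some (is, t)] iff e is the partial equality a =_is t, which
   is identified with t =_is a: Symm only orients equalities having a write
   term on one side. *)
Definition peq_on a f : option (seq (term B) * term B) :=
  if f is PEq l s r then
    if l == Var a then Some (s, r)
    else if r == Var a then Some (s, l) else None
  else None.

Definition value_sort a : sortT B := if a.2 is Arr _ V then V else a.2.

(** * The procedure *)

(* The rules of the first step. Conventions, also used for CaseSplitEq: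
   - The existential quantifier distributes over disjunctions, so a rule whose
     right-hand side is a disjunction yields several formulas (ex a. f_k), each
     of which is then processed on its own; phi[...] in a rule is one such
     disjunct. (Rewriting the whole disjunction at once need not terminate: a
     split then copies the redexes of all the other disjuncts.)
   - phi[t] ~> phi[s] replaces t by s throughout phi. (With a replacement of
     single occurrences, treating rd(wr(t,i,v),j) outside-in in a term with n
     such redexes nested in the index position j makes 2^n copies of the
     innermost one in a single disjunct, each of which is then split
     separately.)
   Which applicable rule is used, and where, is nondeterministic. *)
Inductive simp : form B -> seq (form B) -> Prop :=
| ElimWrRd f t i v j :
    Rd (Wr t i v) j \in fterms f ->
    simp f [:: And (Eq i j) (fsubst (Rd (Wr t i v) j) v f);
               And (Not (Eq i j)) (fsubst (Rd (Wr t i v) j) (Rd t j) f)]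
| ElimWrEq f t1 j v s t2 :
    PEq (Wr t1 j v) s t2 \in atoms f ->
    simp f [:: And (inidx j s)
                   (asubst (PEq (Wr t1 j v) s t2) (PEq t1 s t2) f);
               And (Not (inidx j s))
                   (asubst (PEq (Wr t1 j v) s t2)
                      (And (PEq t1 (rcons s j) t2) (Eq v (Rd t2 j))) f)]
| PartialEq f t1 t2 :
    Eq t1 t2 \in atoms f -> is_arr (sort_of t1) -> is_arr (sort_of t2) ->
    simp f [:: asubst (Eq t1 t2) (PEq t1 [::] t2) f]
| TrivEq f t s :
    PEq t s t \in atoms f ->
    simp f [:: asubst (PEq t s t) Top f]
| Symm f t1 s t2 :
    PEq t1 s t2 \in atoms f -> is_wr t2 -> ~~ is_wr t1 ->
    simp f [:: asubst (PEq t1 s t2) (PEq t2 s t1) f].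

(* The conjunctions produced by LiftEqDiseqRd: other conjuncts, then partial
   equalities on a, then the negations of the partial equalities listed in
   [diseqs], then the equalities s = rd(a,t) for (s,t) in [reads]. *)
Record delta : Type := Delta {
  rest : seq (form B);
  eqs : seq (form B);
  diseqs : seq (form B);
  reads : seq (var B * term B)
}.

Definition read_eq a (q : var B * term B) : form B :=
  Eq (Var q.1) (Rd (Var a) q.2).

Definition delta_conjuncts a (d : delta) : seq (form B) :=
  rest d ++ eqs d ++ map (@Not B) (diseqs d) ++ map (read_eq a) (reads d).

Definition lifted_literal a f : bool :=
  match f with
  | PEq _ _ _ => isSome (peq_on a f)
  | Not g => isSome (peq_on a g)
  | Eq (Var _) (Rd (Var x) _) => x == a
  | _ => false
  end.

(* The conclusion of Ackermann:
   /\_(k < l) (t_k = t_l -> s_k = s_l). *)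
Fixpoint ackermann (qs : seq (var B * term B)) : seq (form B) :=
  match qs with
  | [::] => [::]
  | q :: qs =>
      [seq Imp (Eq q.2 r.2) (Eq (Var q.1) (Var r.1)) | r <- qs] ++ ackermann qs
  end.

(* A disjunct in one of the stages of its processing. [ex] lists the variables
   introduced so far, which are existentially quantified in front of the
   disjunct together with a; in [TReturn] the quantifier on a is gone. The first
   argument of [TSplit] (resp. [TFactor]) lists the partial equalities (resp.
   read terms) already treated. *)
Inductive task : Type :=
| TSimp of form B
| TSplit of seq (form B) & form B
| TFactor of seq (term B) & seq (var B) & form B
| TElimEq of seq (var B) & delta
| TElimDiseq of seq (var B) & delta
| TAckermann of seq (var B) & delta
| TReturn of seq (var B) & form B.

Definition fresh a (ex : seq (var B)) f x : bool :=
  [&& x != a, x \notin ex & ~~ occurs x f].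

Inductive task_step a : task -> seq task -> Prop :=
| SimpRule f fs :
    simp f fs ->
    task_step a (TSimp f) (map TSimp fs)
| SimpFixpoint f :
    ~ (exists fs, simp f fs) ->
    task_step a (TSimp f) [:: TSplit [::] f]
| CaseSplitEq dn f e :
    e \in atoms f -> isSome (peq_on a e) -> e \notin dn ->
    task_step a (TSplit dn f)
      [:: TSplit (e :: dn) (And e (asubst e Top f));
          TSplit (e :: dn) (And (Not e) (asubst e Bot f))]
| CaseSplitEqDone dn f :
    {in atoms f, forall e, isSome (peq_on a e) -> e \in dn} ->
    task_step a (TSplit dn f) [:: TFactor [::] [::] f]
| FactorRd dn ex f t s :
    Rd (Var a) t \in fterms f -> Rd (Var a) t \notin dn ->
    ~~ toccurs a t ->
    s.2 = value_sort a -> fresh a ex f s ->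
    task_step a (TFactor dn ex f)
      [:: TFactor (Rd (Var a) t :: dn) (s :: ex)
            (And (fsubst (Rd (Var a) t) (Var s) f) (Eq (Var s) (Rd (Var a) t)))]
| LiftEqDiseqRd dn ex f d :
    (forall t, Rd (Var a) t \in fterms f -> Rd (Var a) t \in dn) ->
    perm_eq (conjuncts f) (delta_conjuncts a d) ->
    all (fun e => isSome (peq_on a e)) (eqs d) ->
    all (fun e => isSome (peq_on a e)) (diseqs d) ->
    ~~ has (lifted_literal a) (rest d) ->
    task_step a (TFactor dn ex f) [:: TElimEq ex d]
| ElimEq ex r es1 e es2 ds qs s t vs :
    let d := Delta r (es1 ++ e :: es2) ds qs in
    let d' := Delta r (es1 ++ es2) ds qs in
    peq_on a e = Some (s, t) -> ~~ toccurs a t ->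
    size vs = size s -> uniq vs ->
    all (fun v => v.2 == value_sort a) vs ->
    all (fresh a ex (bigand (delta_conjuncts a d))) vs ->
    task_step a (TElimEq ex d)
      [:: TElimDiseq (vs ++ ex)
            (Delta (map (fsubst (Var a) (wrs t s vs)) (delta_conjuncts a d'))
                   [::] [::] [::])]
| ElimEqNone ex d :
    eqs d = [::] ->
    task_step a (TElimEq ex d) [:: TElimDiseq ex d]
| ElimDiseq ex r ds qs :
    (forall e, e \in ds ->
       exists s t, peq_on a e = Some (s, t) /\ ~~ toccurs a t) ->
    only_read a (bigand (r ++ map (read_eq a) qs)) ->
    task_step a (TElimDiseq ex (Delta r [::] ds qs))
      [:: TAckermann ex (Delta r [::] [::] qs)]
| Ackermann ex r qs :
    ~~ occurs a (bigand r) ->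
    all (fun q => (q.1 != a) && ~~ toccurs a q.2) qs ->
    task_step a (TAckermann ex (Delta r [::] [::] qs))
      [:: TReturn ex (And (bigand r) (bigand (ackermann qs)))].

(* The state of the procedure: the disjuncts of the current formula. It starts
   with ex a. phi and has terminated, with result \/_k psi_k, when all of its
   disjuncts are of the form [TReturn ex_k psi_k]. *)
Definition state : Type := seq task.

Definition start f : state := [:: TSimp f].

Definition returned (st : state) : bool :=
  all (fun d => if d is TReturn _ _ then true else false) st.

Inductive step a : state -> state -> Prop :=
| Step l d ds r :
    task_step a d ds -> step a (l ++ d :: r) (l ++ ds ++ r).

Definition delta_size a (d : delta) : nat :=
  fsize (bigand (delta_conjuncts a d)).

Definition task_size a (d : task) : nat :=
  match d with
  | TSimp f => fsize f
  | TSplit _ f => fsize f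
  | TFactor _ ex f => size ex + fsize f
  | TElimEq ex d | TElimDiseq ex d | TAckermann ex d =>
      size ex + delta_size a d
  | TReturn ex f => size ex + fsize f
  end.

Definition state_size a (st : state) : nat := sumn (map (task_size a) st).

(* [run a st T st']: an execution from st to st' taking time T, where each step
   costs the size of the whole formula before it plus the size of the whole
   formula after it. Every step has positive cost from a reachable state, so a
   bound on T excludes infinite executions. *)
Inductive run a (st : state) : nat -> state -> Prop :=
| RunNil : run a st 0 st
| RunStep T st1 st2 :
    run a st T st1 -> step a st1 st2 ->
    run a st (T + (state_size a st1 + state_size a st2)) st2.

End Syntax.

(** * Structures of the theory of arrays *)

Record array_structure (B : Type) : Type := ArrayStructure {
  dom : sortT B -> Type;
  rd : forall I V, dom (Arr I V) -> dom (Basic I) -> dom V;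
  wr : forall I V, dom (Arr I V) -> dom (Basic I) -> dom V -> dom (Arr I V);
  read_over_write_eq : forall I V (b : dom (Arr I V)) i v,
    rd (wr b i v) i = v;
  read_over_write_neq : forall I V (b : dom (Arr I V)) i j v,
    i <> j -> rd (wr b i v) j = rd b j;
  extensionality : forall I V (b c : dom (Arr I V)),
    (forall i, rd b i = rd c i) -> b = c
}.

Definition infinite_type (D : Type) : Prop := exists u : nat -> D, injective u.

(* Main.v *)
(* Call weight of a term the number of its symbols outside index positions,
   where a read does not count. Contracting a redex [rd(wr(t,i,v),j)] decreases
   it, and [rd(t,j)] weighs the same as [t]. Give a partial equality the product
   of the weights of its sides: since (1 + x + y) z > x z + y z, ElimWrEq
   decreases the sum of these products over the distinct array equations, and it
   adds a single term, of weight at most n = |phi|. Hence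
     (n + 1) * (products of the distinct array equations)
       + (weights of the distinct terms)
   bounds the number of steps of the first phase on a branch. It is O(n^4)
   initially, and the numbers of case splits and of factored reads on a branch
   are also below it. A step has at most two results and multiplies the size of a
   disjunct by a polynomial factor (the four last steps square it at most twice),
   so there are 2^poly(n) disjuncts, each of size 2^poly(n).

   The procedure is never stuck: at a fixed point of the first step no write
   term is left, so that [a] occurs only in read terms and as one side of partial
   equalities; the case splits make the latter conjuncts, and factoring the
   innermost reads first removes [a] from everything but the factored
   equations. *)
Require Import Defs.
From mathcomp Require Import all_boot.
From mathcomp Require Import zify.
From Stdlib Require Import Classical_Prop.
From Stdlib Require List.

Set Implicit Arguments.
Unset Strict Implicit.
Unset Printing Implicit Defensive.

(* [all_boot] shadows this name with the size of a tuple. *)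
Local Notation tsize := Defs.tsize.

(** * Sums over the distinct elements of a list *)

Section DistinctSum.
Variable T : eqType.
Implicit Types (w : T -> nat) (s : seq T) (x : T).

(** Repetitions are not counted: a rule rewrites all occurrences of a term or an atom at once, so
    the copies that a step makes must not add weight. *)
Definition dsum w s : nat := \sum_(x <- undup s) w x.

Lemma dsum_rem w s x : x \in s ->
  dsum w s = w x + dsum w [seq y <- s | y != x].
Proof.
move=> xs; rewrite /dsum -filter_undup big_filter.
rewrite (bigD1_seq x) ?undup_uniq ?mem_undup //=.
Qed.

Lemma leq_dsum w w' s : {in s, forall x, w x <= w' x} -> dsum w s <= dsum w' s.
Proof.
move=> le_ww'; rewrite /dsum big_seq [leqRHS]big_seq.
by apply: leq_sum => x; rewrite mem_undup; exact: le_ww'.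
Qed.

Lemma ltn_dsum w w' s x :
  {in s, forall y, w y <= w' y} -> x \in s -> w x < w' x ->
  dsum w s < dsum w' s.
Proof.
move=> le_ww' xs lt_x; rewrite (dsum_rem _ xs) (dsum_rem w' xs) -addSn leq_add //.
by apply: leq_dsum => y; rewrite mem_filter => /andP[_]; exact: le_ww'.
Qed.

Lemma dsum_leq_size w s k : {in s, forall x, w x <= k} -> dsum w s <= size s * k.
Proof.
move=> le_wk; apply: leq_trans (leq_dsum le_wk) _.
by rewrite /dsum big_const_seq count_predT iter_addn_0 mulnC leq_mul2r size_undup orbT.
Qed.

End DistinctSum.

(** Distinct elements of [s] have distinct preimages in [t], so each can be charged to its own
    preimage. Thus a substitution may merge terms but never multiplies them in the sum. *)
Lemma dsum_image (T U : eqType) (w : U -> nat) (h : T -> U) (s : seq U) (t : seq T) :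
  {in s, forall y, exists2 x, x \in t & y = h x} ->
  dsum w s <= dsum (w \o h) t.
Proof.
have [n] := ubnP (size s); elim: n s t => // n IHn s t le_sn st.
have [->|[y ys]] : s = [::] \/ exists y, y \in s.
- by case: (s) => [|y s']; [left|right; exists y; rewrite mem_head].
- by rewrite /dsum big_nil.
have [x xt def_y] := st y ys; rewrite (dsum_rem w ys) (dsum_rem _ xt) /= -def_y.
rewrite leq_add2l; apply: IHn.
  have cnt_y : 0 < count (pred1 y) s by rewrite -has_count has_pred1.
  rewrite size_filter; change (count (predC (pred1 y)) s < n).
  by move: cnt_y le_sn; rewrite -(count_predC (pred1 y) s); lia.
move=> z; rewrite mem_filter => /andP[zy /st[x' x't def_z]].
exists x' => //; rewrite mem_filter x't andbT.
by apply: contraNneq zy => x'x; rewrite def_z x'x def_y.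
Qed.

Lemma dsum_cat (T : eqType) (w : T -> nat) (s t : seq T) :
  dsum w (s ++ t) <= dsum w s + dsum w t.
Proof.
elim: s => [|x s IHs] /=; first by rewrite /dsum big_nil.
rewrite /dsum /= -/(dsum w (s ++ t)) mem_cat.
case: ifP => /= [/orP[xs|xt]|/negbT].
- by rewrite xs.
- case: (x \in s) => //; rewrite big_cons -addnA.
  exact: leq_trans IHs (leq_addl _ _).
- by rewrite negb_or => /andP[/negbTE-> _]; rewrite !big_cons -addnA leq_add2l.
Qed.

Lemma dsum_sub (T : eqType) (w : T -> nat) (s t : seq T) :
  {subset s <= t} -> dsum w s <= dsum w t.
Proof. by move=> st; apply: (@dsum_image _ _ w id) => y /st; exists y. Qed.

Lemma dsum_leq_add (T : eqType) (w : T -> nat) (s t u : seq T) :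
  {subset s <= t ++ u} -> dsum w s <= dsum w t + dsum w u.
Proof. by move=> s_tu; apply: leq_trans (dsum_sub w s_tu) (dsum_cat w t u). Qed.

Lemma dsum_nil (T : eqType) (w : T -> nat) : dsum w [::] = 0.
Proof. by rewrite /dsum big_nil. Qed.

Lemma dsum_seq1 (T : eqType) (w : T -> nat) x : dsum w [:: x] = w x.
Proof. by rewrite /dsum /= big_seq1. Qed.

Lemma dsum_cons (T : eqType) (w : T -> nat) x (s : seq T) :
  dsum w (x :: s) <= w x + dsum w s.
Proof. by apply: leq_trans (dsum_cat w [:: x] s) _; rewrite dsum_seq1. Qed.

Lemma dsum0 (T : eqType) (w : T -> nat) (s : seq T) :
  {in s, forall x, w x = 0} -> dsum w s = 0.
Proof.
move=> w0; apply/eqP; rewrite -leqn0 -(muln0 (size s)).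
by apply: dsum_leq_size => x /w0 ->.
Qed.

(** * Subterms, atoms, conjuncts and substitution *)

Section Syntax.
Variable B : eqType.
Implicit Types (t u v R S : term B) (f g h E : form B) (a x : var B).

Lemma subterms_refl t : t \in subterms t.
Proof. by case: t => *; rewrite mem_head. Qed.

Lemma subterms_trans t u v : u \in subterms v -> t \in subterms u -> t \in subterms v.
Proof.
elim: v => [x|v1 IH1 v2 IH2|v1 IH1 v2 IH2 v3 IH3] /=; rewrite in_cons => /orP[/eqP-> //|] //.
- by rewrite mem_cat in_cons mem_cat => /orP[/IH1 H|/IH2 H] /H ->; rewrite !orbT.
- by rewrite !mem_cat in_cons !mem_cat => /or3P[/IH1 H|/IH2 H|/IH3 H] /H ->; rewrite !orbT.
Qed.

Lemma tsize_gt0 t : 0 < tsize t.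
Proof. by case: t. Qed.

Lemma fsize_gt0 f : 0 < fsize f.
Proof. by case: f. Qed.

Lemma subterms_size t u : u \in subterms t -> (u == t) || (tsize u < tsize t).
Proof.
elim: t => [x|t1 IH1 t2 IH2|t1 IH1 t2 IH2 t3 IH3] /=; rewrite in_cons => /orP[->//|] //.
- by rewrite mem_cat => /orP[/IH1|/IH2] /orP[/eqP->|]; lia.
- by rewrite !mem_cat => /or3P[/IH1|/IH2|/IH3] /orP[/eqP->|]; lia.
Qed.

Lemma subterms_leq t u : u \in subterms t -> tsize u <= tsize t.
Proof. by case/subterms_size/orP => [/eqP->|/ltnW]. Qed.

Lemma fterms_atoms f u :
  u \in fterms f <-> exists2 E, E \in atoms f & u \in fterms E.
Proof.
elim: f => [||t s|t s r|f //|f IHf g IHg|f IHf g IHg|f IHf g IHg] /=.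
- by split=> // -[].
- by split=> // -[].
- by split=> [H|[E]]; [exists (Eq t s); rewrite ?mem_head|rewrite inE => /eqP->].
- by split=> [H|[E]]; [exists (PEq t s r); rewrite ?mem_head|rewrite inE => /eqP->].
all: rewrite mem_cat; split=> [/orP[/IHf|/IHg] [E Ef uE]|[E]].
all: try by exists E => //; rewrite mem_cat Ef ?orbT.
all: rewrite mem_cat => /orP[Ef|Eg] uE; apply/orP;
       by [left; apply/IHf; exists E|right; apply/IHg; exists E].
Qed.

Lemma fterms_sub f u v : u \in fterms f -> v \in subterms u -> v \in fterms f.
Proof.
move=> /fterms_atoms[E Ef uE] vu; apply/fterms_atoms; exists E => // {f Ef}.
elim: E uE => [//|//|t s|t s r|f //|f IHf g IHg|f IHf g IHg|f IHf g IHg] /=.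
- by rewrite !mem_cat => /orP[] /subterms_trans ->; rewrite ?orbT.
- rewrite !mem_cat => /or3P[|/flattenP[_ /mapP[i si ->]]|] /subterms_trans H; first by rewrite H.
    suff -> : v \in flatten (map (@subterms B) s) by rewrite orbT.
    by apply/flattenP; exists (subterms i); rewrite ?map_f // H.
  by rewrite H ?orbT.
all: by rewrite !mem_cat => /orP[/IHf->|/IHg->]; rewrite ?orbT.
Qed.

Lemma atoms_atom f E :
  E \in atoms f -> atoms E = [:: E] /\ fsize E <= fsize f.
Proof.
elim: f => [//|//|t s|t s r|f IHf|f IHf g IHg|f IHf g IHg|f IHf g IHg] /=.
- by rewrite inE => /eqP->.
- by rewrite inE => /eqP->.
- by move=> /IHf[-> ?]; split=> //; lia.
all: by rewrite mem_cat => /orP[/IHf|/IHg] [-> ?]; split=> //; lia.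
Qed.

Lemma atom_shape f E :
  E \in atoms f -> (exists t u, E = Eq t u) \/ (exists t s u, E = PEq t s u).
Proof.
elim: f => [//|//|t s|t s r|f IHf|f IHf g IHg|f IHf g IHg|f IHf g IHg] //=.
- by rewrite inE => /eqP->; left; exists t, s.
- by rewrite inE => /eqP->; right; exists t, s, r.
all: by rewrite mem_cat => /orP[/IHf|/IHg].
Qed.

Lemma tsize_sumn (s : seq (term B)) t : t \in s -> tsize t <= sumn (map (@tsize B) s).
Proof. by elim: s => //= u s IHs; rewrite inE => /orP[/eqP->|/IHs]; lia. Qed.

Lemma fterms_size f u : u \in fterms f -> tsize u < fsize f.
Proof.
elim: f => [//|//|t s|t s r|f IHf|f IHf g IHg|f IHf g IHg|f IHf g IHg] /=.
- by rewrite mem_cat => /orP[] /subterms_leq; lia.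
- rewrite !mem_cat => /or3P[/subterms_leq|/flattenP[_ /mapP[i si ->] /subterms_leq]|/subterms_leq]; try lia.
  have := tsize_sumn si; lia.
- by move/IHf; lia.
all: by rewrite mem_cat => /orP[/IHf|/IHg]; lia.
Qed.

Lemma size_subterms t : size (subterms t) = tsize t.
Proof.
by elim: t => //= [t IHt u IHu|t IHt u IHu v IHv]; rewrite !size_cat ?IHt ?IHu ?IHv; lia.
Qed.

Lemma size_fterms f : size (fterms f) <= fsize f.
Proof.
elim: f => //= [t s|t s r|f IHf|f IHf g IHg|f IHf g IHg|f IHf g IHg];
  rewrite ?size_cat ?size_subterms; try lia.
rewrite size_flatten /shape -map_comp (eq_map (g := @tsize B)); first lia.
exact: size_subterms.
Qed.

Lemma size_atoms f : size (atoms f) <= fsize f.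
Proof.
by elim: f => //= [f IHf|f IHf g IHg|f IHf g IHg|f IHf g IHg]; rewrite ?size_cat; lia.
Qed.

Lemma atoms_fsubst R S f : atoms (fsubst R S f) = map (fsubst R S) (atoms f).
Proof. by elim: f => //= f -> g ->; rewrite map_cat. Qed.

Lemma conjuncts_fsubst R S f : conjuncts (fsubst R S f) = map (fsubst R S) (conjuncts f).
Proof. by elim: f => //= f -> g ->; rewrite map_cat. Qed.

(** The clause [E' != E] is what makes the measures drop when an atom is rewritten or split on. *)
Lemma atoms_asubst E h f E' :
  E' \in atoms (asubst E h f) -> E' \in atoms h \/ (E' \in atoms f) && (E' != E).
Proof.
elim: f => [//|//|t s|t s r|f IHf|f IHf g IHg|f IHf g IHg|f IHf g IHg] //=.
- by case: eqP => [_|/eqP nE]; [left|rewrite /= inE => /eqP->; right; rewrite eqxx nE].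
- by case: eqP => [_|/eqP nE]; [left|rewrite /= inE => /eqP->; right; rewrite eqxx nE].
all: by rewrite !mem_cat => /orP[/IHf|/IHg] [|/andP[-> ->]]; rewrite ?orbT; auto.
Qed.

Lemma fterms_atom_sub f E u : E \in atoms f -> u \in fterms E -> u \in fterms f.
Proof. by move=> Ef uE; apply/fterms_atoms; exists E. Qed.

Lemma fterms_asubst E h f u :
  u \in fterms (asubst E h f) -> u \in fterms h \/ u \in fterms f.
Proof.
move=> /fterms_atoms[E' /atoms_asubst[E'h|/andP[E'f _]] uE'].
  by left; apply: fterms_atom_sub uE'.
by right; apply: fterms_atom_sub uE'.
Qed.

Lemma fsize_asubst E h f k : fsize h <= k * fsize E ->
  fsize (asubst E h f) <= k.+1 * fsize f.
Proof.
move=> le_h; elim: f => [||t s|t s r|f IHf|f IHf g IHg|f IHf g IHg|f IHf g IHg] /=; try nia.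
- by case: eqP => [e|_] /=; [move: le_h; rewrite -e /=|]; nia.
- by case: eqP => [e|_] /=; [move: le_h; rewrite -e /=|]; nia.
Qed.

Lemma subterms_tsubst R S t u : u \in subterms (tsubst R S t) ->
  u \in subterms S \/ exists2 v, v \in subterms t & u = tsubst R S v.
Proof.
elim: t => [x|t1 IH1 t2 IH2|t1 IH1 t2 IH2 t3 IH3].
- rewrite /=; case: ifP => [_|xR]; first by left.
  by rewrite inE => /eqP->; right; exists (Var x); rewrite ?subterms_refl //= xR.
- rewrite /=; case: ifP => [_|tR]; first by left.
  rewrite /= inE => /orP[/eqP->|].
    by right; exists (Rd t1 t2); rewrite ?subterms_refl //= tR.
  rewrite mem_cat => /orP[/IH1|/IH2] [|[v vt ->]]; auto;
    by right; exists v => //; rewrite inE mem_cat vt !orbT.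
- rewrite /=; case: ifP => [_|tR]; first by left.
  rewrite /= inE => /orP[/eqP->|].
    by right; exists (Wr t1 t2 t3); rewrite ?subterms_refl //= tR.
  rewrite !mem_cat => /or3P[/IH1|/IH2|/IH3] [|[v vt ->]]; auto;
    by right; exists v => //; rewrite inE !mem_cat vt !orbT.
Qed.

Lemma fterms_fsubst R S f u : u \in fterms (fsubst R S f) ->
  u \in subterms S \/ exists2 v, v \in fterms f & u = tsubst R S v.
Proof.
elim: f => [//|//|t s|t s r|f IHf|f IHf g IHg|f IHf g IHg|f IHf g IHg] //=.
- by rewrite mem_cat => /orP[] /subterms_tsubst[|[v vt ->]]; auto; right;
    exists v; rewrite // mem_cat vt ?orbT.
- rewrite !mem_cat => /or3P[/subterms_tsubst[|[v vt ->]]||/subterms_tsubst[|[v vt ->]]]; auto.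
  + by right; exists v; rewrite // !mem_cat vt ?orbT.
  + move=> /flattenP[_ /mapP[_ /mapP[i si ->] ->] /subterms_tsubst[|[v vt ->]]]; auto.
    right; exists v => //; rewrite !mem_cat; apply/or3P/Or32.
    by apply/flattenP; exists (subterms i) => //; apply: map_f.
  + by right; exists v; rewrite // !mem_cat vt ?orbT.
all: by rewrite mem_cat => /orP[/IHf|/IHg] [|[v vt ->]]; auto; right;
    exists v; rewrite // mem_cat vt ?orbT.
Qed.

Lemma tsubst_id R S t : R \notin subterms t -> tsubst R S t = t.
Proof.
elim: t => [x|t1 IH1 t2 IH2|t1 IH1 t2 IH2 t3 IH3]; rewrite /= in_cons negb_or eq_sym.
- by case/andP=> /negbTE->.
- by rewrite mem_cat negb_or => /and3P[/negbTE-> /IH1-> /IH2->].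
- by rewrite !mem_cat !negb_or => /and4P[/negbTE-> /IH1-> /IH2-> /IH3->].
Qed.

Lemma tsubst_refl R S : tsubst R S R = S.
Proof. by case: R => *; rewrite /= eqxx. Qed.

Lemma tsize_tsubst R S t k : 0 < k -> tsize S <= k -> tsize (tsubst R S t) <= k * tsize t.
Proof.
move=> k0 le_S.
elim: t => [x|t1 IH1 t2 IH2|t1 IH1 t2 IH2 t3 IH3] /=; case: ifP => _ /=; nia.
Qed.

Lemma fsize_fsubst R S f k : 0 < k -> tsize S <= k -> fsize (fsubst R S f) <= k * fsize f.
Proof.
move=> k0 le_S; have le_t t := tsize_tsubst R t k0 le_S.
elim: f => [||t s|t s r|f IHf|f IHf g IHg|f IHf g IHg|f IHf g IHg] /=; try nia.
- by have := le_t t; have := le_t s; nia.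
- have := le_t t; have := le_t r.
  have : sumn [seq tsize i | i <- [seq tsubst R S i | i <- s]] <= k * sumn (map (@tsize B) s).
    by elim: s => //= i s; have := le_t i; nia.
  rewrite mulnS !mulnDr => *; rewrite -add1n; do 3?[apply: leq_add => //].
Qed.

Lemma tsize_tsubst_le R S t : tsize S <= tsize R -> tsize (tsubst R S t) <= tsize t.
Proof.
move=> le_S.
by elim: t => [x|t1 IH1 t2 IH2|t1 IH1 t2 IH2 t3 IH3] /=; case: eqP => [e|_] /=;
  (try by rewrite -e /= in le_S); lia.
Qed.

Lemma fsize_fsubst_le R S f : tsize S <= tsize R -> fsize (fsubst R S f) <= fsize f.
Proof.
move=> le_S; have le_t t := tsize_tsubst_le t le_S.
elim: f => [||t s|t s r|f IHf|f IHf g IHg|f IHf g IHg|f IHf g IHg] /=; try lia.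
- by have := le_t t; have := le_t s; lia.
- have := le_t t; have := le_t r.
  have : sumn [seq tsize i | i <- [seq tsubst R S i | i <- s]] <= sumn (map (@tsize B) s).
    by elim: s => //= i s; have := le_t i; lia.
  by move=> *; rewrite ltnS !leq_add.
Qed.

Lemma atoms_conjuncts f E :
  E \in atoms f <-> exists2 c, c \in conjuncts f & E \in atoms c.
Proof.
have base g : conjuncts g = [:: g] ->
  E \in atoms g <-> exists2 c, c \in conjuncts g & E \in atoms c.
  by move=> ->; split=> [Eg|[c]]; [exists g; rewrite ?mem_head|rewrite inE => /eqP->].
elim: f; try by move=> *; exact: base.
move=> f IHf g IHg /=; rewrite mem_cat; split=> [/orP[/IHf|/IHg] [c cf Ec]|[c]].
- by exists c; rewrite // mem_cat cf.
- by exists c; rewrite // mem_cat cf orbT.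
rewrite mem_cat => /orP[cf|cg] Ec; apply/orP; [left; apply/IHf|right; apply/IHg]; by exists c.
Qed.

Lemma fterms_conjuncts f u :
  u \in fterms f <-> exists2 c, c \in conjuncts f & u \in fterms c.
Proof.
split=> [/fterms_atoms[E /atoms_conjuncts[c cf Ec] uE]|[c cf /fterms_atoms[E Ec uE]]].
  by exists c => //; apply/fterms_atoms; exists E.
by apply/fterms_atoms; exists E => //; apply/atoms_conjuncts; exists c.
Qed.

Lemma fterms_bigand (cs : seq (form B)) u :
  u \in fterms (bigand cs) <-> exists2 c, c \in cs & u \in fterms c.
Proof.
elim: cs => [|c cs IH] /=; first by split=> // -[].
rewrite mem_cat; split=> [/orP[uc|/IH[c' c's uc']]|[c']].
- by exists c; rewrite ?mem_head.
- by exists c'; rewrite // inE c's orbT.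
by rewrite inE => /orP[/eqP->->//|c's uc']; apply/orP; right; apply/IH; exists c'.
Qed.

Lemma fsize_bigand (cs : seq (form B)) : fsize (bigand cs) = (sumn [seq (fsize c).+1 | c <- cs]).+1.
Proof. by elim: cs => //= c cs ->; lia. Qed.

(** Combined with [fsize_bigand]: rebuilding a formula from its conjuncts, in any order, adds
    exactly 2 to its size. *)
Lemma fsize_conjuncts f : sumn [seq (fsize c).+1 | c <- conjuncts f] = (fsize f).+1.
Proof.
elim: f => //= [*|*|f _|f IHf g IHg|*|*]; rewrite ?addn0 //.
by rewrite map_cat sumn_cat IHf IHg; lia.
Qed.

End Syntax.

(** * Termination of the first step *)

Section Simplification.
Variable B : eqType.
Implicit Types (t u v R S : term B) (f g h E : form B) (a x : var B).

Lemma sort_of_tsubst R S t :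
  sort_of R = sort_of S -> sort_of (tsubst R S t) = sort_of t.
Proof.
move=> RS; elim: t => [x|t1 IH1 t2 IH2|t1 IH1 t2 IH2 t3 IH3] /=;
  case: eqP => [e|_]; by [rewrite -RS -e|rewrite /= ?IH1 ?IH2 ?IH3].
Qed.

Lemma well_sorted_fsubst R S f :
  sort_of R = sort_of S -> well_sorted (fsubst R S f) = well_sorted f.
Proof.
move=> RS; have st t := sort_of_tsubst t RS.
elim: f => //= [t u|t s u|f -> g ->|f -> g ->|f -> g ->] //; rewrite !st //.
case: (sort_of t) => // -[//|b V]; congr andb.
by rewrite all_map; apply: eq_all => i /=; rewrite st.
Qed.

Lemma well_sorted_asubst E h f :
  well_sorted f -> well_sorted h -> well_sorted (asubst E h f).
Proof.
move=> + wh; elim: f => //= [t u|t s u|f IHf g IHg|f IHf g IHg|f IHf g IHg].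
1,2: by case: ifP.
all: by move=> /andP[/IHf-> /IHg->].
Qed.

Lemma well_sorted_atom f E : well_sorted f -> E \in atoms f -> well_sorted E.
Proof.
elim: f => //= [t u|t s u|f IHf g IHg|f IHf g IHg|f IHf g IHg].
1,2: by move=> w; rewrite inE => /eqP->.
all: by move=> /andP[/IHf Hf /IHg Hg]; rewrite mem_cat => /orP[/Hf|/Hg].
Qed.

Lemma sorted_Rd t i : sort_of (Rd t i) != None ->
  exists b V, [/\ sort_of t = Some (Arr b V), sort_of i = Some (Basic b)
                & sort_of (Rd t i) = Some V].
Proof.
rewrite /=; case: (sort_of t) => // -[//|b V]; case: (sort_of i) => // s.
by case: (s =P Basic b) => [->|//] _; exists b, V.
Qed.

Lemma sorted_Wr t i v : sort_of (Wr t i v) != None ->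
  exists b V, [/\ sort_of t = Some (Arr b V), sort_of i = Some (Basic b),
                  sort_of v = Some V & sort_of (Wr t i v) = Some (Arr b V)].
Proof.
rewrite /=; case: (sort_of t) => // -[//|b V]; case: (sort_of i) => // s.
case: (sort_of v) => // s'.
by case: (s =P Basic b) => [->|//]; case: (s' =P V) => [->|//] _; exists b, V.
Qed.

Lemma sorted_subterm t u : sort_of t != None -> u \in subterms t -> sort_of u != None.
Proof.
elim: t => [x|t1 IH1 t2 IH2|t1 IH1 t2 IH2 t3 IH3] st; rewrite in_cons => /orP[/eqP->|] //.
- by have [b [V [s1 s2 _]]] := sorted_Rd st; rewrite mem_cat => /orP[/IH1|/IH2]; apply; rewrite ?s1 ?s2.
- have [b [V [s1 s2 s3 _]]] := sorted_Wr st.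
  by rewrite !mem_cat => /or3P[/IH1|/IH2|/IH3]; apply; rewrite ?s1 ?s2 ?s3.
Qed.

Lemma well_sorted_PEq t s u : well_sorted (PEq t s u) ->
  exists b V, [/\ sort_of t = Some (Arr b V), sort_of u = Some (Arr b V)
                & {in s, forall i, sort_of i = Some (Basic b)}].
Proof.
rewrite /=; case: (sort_of t) => // -[//|b V] /andP[/eqP-> /allP si].
by exists b, V; split=> // i /si/eqP.
Qed.

Lemma sorted_fterm f u : well_sorted f -> u \in fterms f -> sort_of u != None.
Proof.
move=> wf /fterms_atoms[E Ef uE]; have := well_sorted_atom wf Ef.
case: (atom_shape Ef) uE => [[t [r ->]]|[t [s [r ->]]]].
  rewrite mem_cat => + /andP[st /eqP tr]; have sr := st; rewrite tr in sr.
  by move=> /orP[]; apply: sorted_subterm.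
move=> uE /well_sorted_PEq[b [V [st sr si]]].
move: uE; rewrite !mem_cat => /or3P[|/flattenP[_ /mapP[i /si ii ->]]|];
  by apply: sorted_subterm; rewrite ?st ?ii ?sr.
Qed.

(* The indices are ignored, so that contracting a redex [Rd (Wr t i v) j] to [v]
   or to [Rd t j] decreases the weight, while [Rd t j] weighs the same as [t]. *)
Fixpoint tweight t : nat :=
  match t with
  | Var _ => 1
  | Rd t _ => tweight t
  | Wr t _ v => (tweight t + tweight v).+1
  end.

(* If [t1], [v] and [t2] weigh x, y and z then ElimWrEq replaces the leading
   term 6 (1 + x + y) z by 6 x z + 6 y z: the product of the weights is
   compatible with splitting off the equality [v = rd(t2,j)]. The last summand
   accounts for Symm, and decreases also when a contraction turns a side into a
   write term. *)
Definition aweight E : nat :=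
  match E with
  | Eq l r => if is_arr (sort_of l) then 6 * (tweight l * tweight r) + 3 else 0
  | PEq l _ r => 6 * (tweight l * tweight r)
                 + (if is_wr l then 0 else if is_wr r then 1 else 2)
  | _ => 0
  end.

(** [N] bounds the weights of the terms. Rewriting an atom lowers the first sum by at least 1, and
    the factor [N.+1] turns this into enough to pay for the one new term that ElimWrEq can add. *)
Definition measure N f : nat :=
  N.+1 * dsum aweight (atoms f) + dsum tweight (fterms f).

Lemma tweight_gt0 t : 0 < tweight t.
Proof. by elim: t. Qed.

Lemma tweight_tsize t : tweight t <= tsize t.
Proof. by elim: t => //=; lia. Qed.

Lemma tweight_tsubst R S t : tweight S <= tweight R -> tweight (tsubst R S t) <= tweight t.
Proof.
move=> le_S.
by elim: t => [x|t1 IH1 t2 IH2|t1 IH1 t2 IH2 t3 IH3] /=; case: eqP => [e|_] //=;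
  (try by rewrite -e in le_S); lia.
Qed.

(** As [R] is not a write term, a side that is a write term remains one, so the summand accounting
    for Symm cannot grow. *)
Lemma aweight_fsubst R S E : ~~ is_wr R -> tweight S <= tweight R ->
  sort_of R = sort_of S -> aweight (fsubst R S E) <= aweight E.
Proof.
move=> wR le_S RS; have tw t := tweight_tsubst t le_S.
have wr t : is_wr t -> is_wr (tsubst R S t).
  by case: t => //= t1 t2 t3 _; case: eqP wR => // <-.
case: E => //= [l r|l s r].
  by rewrite sort_of_tsubst //; case: ifP => // _; rewrite leq_add2r leq_mul2l leq_mul.
apply: leq_add; first by rewrite leq_mul2l leq_mul.
case: (is_wr l) (wr l) => [->//|_]; case: (is_wr r) (wr r) => [->//|_];
  by do 2?case: ifP.
Qed.

Lemma measure_atom N f f' E (L : seq (form B)) (K : seq (term B)) :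
  E \in atoms f -> {subset atoms f' <= L ++ [seq x <- atoms f | x != E]} ->
  {subset fterms f' <= K ++ fterms f} ->
  dsum aweight L < aweight E -> dsum tweight K <= N ->
  measure N f' < measure N f.
Proof.
move=> Ef sub_a sub_t ltL leK; rewrite /measure (dsum_rem _ Ef).
have := dsum_leq_add aweight sub_a; have := dsum_leq_add tweight sub_t.
by nia.
Qed.

(** All new atoms are images of old ones or weightless, so the first sum does not grow; in the
    second sum, [R] drops to the weight of [S]. *)
Lemma measure_redex N f f' R S (L : seq (form B)) :
  R \in fterms f -> ~~ is_wr R -> sort_of R = sort_of S -> tweight S < tweight R ->
  {subset atoms f' <= L ++ map (fsubst R S) (atoms f)} ->
  {in L, forall E, aweight E = 0} ->
  {subset fterms f' <= map (tsubst R S) (fterms f)} ->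
  measure N f' < measure N f.
Proof.
move=> Rf wR RS ltS sub_a L0 sub_t; rewrite /measure -addnS; apply: leq_add.
  rewrite leq_mul2l; apply/orP; right.
  apply: leq_trans (dsum_leq_add _ sub_a) _; rewrite (dsum0 L0) add0n.
  apply: leq_trans (dsum_image (h := fsubst R S) (t := atoms f) _ _) _.
    by move=> _ /mapP[x xf ->]; exists x.
  by apply: leq_dsum => x _; apply: aweight_fsubst => //; apply: ltnW.
apply: leq_ltn_trans (dsum_image (h := tsubst R S) (t := fterms f) _ _) _.
  by move=> _ /sub_t/mapP[x xf ->]; exists x.
apply: (ltn_dsum (x := R)) => //=; last by rewrite tsubst_refl.
by move=> x _; apply: tweight_tsubst; apply: ltnW.
Qed.

(** The guard of ElimWrEq copies [j] once for every listed index, so the length of the index lists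
    governs the growth of the formula in one step. *)
Definition small_indices L f : Prop :=
  forall t s u, PEq t s u \in atoms f -> size s <= L.

Definition light N f : Prop := {in fterms f, forall u, tweight u <= N}.

Lemma fterms_inidx j (s : seq (term B)) u :
  u \in fterms (inidx j s) -> u \in subterms j \/ exists2 i, i \in s & u \in subterms i.
Proof.
elim: s => //= i s IHs; rewrite !mem_cat => /orP[/orP[|ui]|/IHs[|[i' si' ui']]]; auto; right.
  by exists i; rewrite ?mem_head.
by exists i'; rewrite // inE si' orbT.
Qed.

Lemma atoms_inidx j (s : seq (term B)) : atoms (inidx j s) = [seq Eq j i | i <- s].
Proof. by elim: s => //= i s ->. Qed.

Lemma fsize_inidx j (s : seq (term B)) :
  fsize (inidx j s) = (size s * (tsize j + 2) + sumn (map (@tsize B) s)).+1.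
Proof. by elim: s => //= i s ->; rewrite mulSn; lia. Qed.

Lemma well_sorted_inidx b j (s : seq (term B)) :
  sort_of j = Some (Basic b) -> {in s, forall i, sort_of i = Some (Basic b)} ->
  well_sorted (inidx j s).
Proof.
move=> sj; elim: s => //= i s IHs si; rewrite sj (si i) ?mem_head //= eqxx /=.
by apply: IHs => i' s'; rewrite si // inE s' orbT.
Qed.


(** ElimWrEq appends one index, hence [L.+1]. The factor [L + 10] covers a guard of size at most
    [(L + 5) * fsize f], a rewritten formula of size at most [4 * fsize f], and the conjunction of
    the two. *)
Definition simp_decreases N L f g : Prop :=
  [/\ well_sorted g, light N g, small_indices L.+1 g, measure N g < measure N f
    & fsize g <= (L + 10) * fsize f].

Lemma aweight_PEq t s u : 0 < aweight (PEq t s u).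
Proof. by have := tweight_gt0 t; have := tweight_gt0 u; rewrite /=; nia. Qed.

Lemma light_fsubst N R S f g : {subset fterms g <= map (tsubst R S) (fterms f)} ->
  tweight S <= tweight R -> light N f -> light N g.
Proof.
move=> sub le_S lf u /sub/mapP[v vf ->].
exact: leq_trans (tweight_tsubst _ le_S) (lf v vf).
Qed.

(** Proper subterms of the redex are smaller than it and hence fixed by the substitution. So the
    terms in the guard and in [S] are images of old terms, or [S] itself, the image of [R]: no term
    is created. *)
Lemma simp_redex N L f t i v j S q :
  let R := Rd (Wr t i v) j in
  well_sorted f -> light N f -> small_indices L f -> R \in fterms f ->
  S = v \/ S = Rd t j -> q = Eq i j \/ q = Not (Eq i j) ->
  simp_decreases N L f (And q (fsubst R S f)).
Proof.
move=> R wf lf sf Rf defS defq.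
have sR := sorted_fterm wf Rf.
have [b [V [st sj sRV]]] := sorted_Rd sR.
have [|b' [V' [st' si sv]]] := sorted_Wr (t := t) (i := i) (v := v); first by rewrite st.
rewrite st => -[eb eV]; rewrite -{b'}eb -{V'}eV in st' si sv.
have RS : sort_of R = sort_of S.
  by rewrite sRV; case: defS => ->; rewrite ?sv //= st' sj eqxx.
have ltS : tweight S < tweight R by case: defS => -> /=; lia.
have leS : tsize S <= tsize R by case: defS => -> /=; lia.
have Rs u : u \in subterms (Wr t i v) -> tsubst R S u = u.
  move=> us; apply: tsubst_id; apply/negP => /subterms_leq.
  by move: (subterms_leq us); rewrite /=; lia.
have Rj u : u \in subterms j -> tsubst R S u = u.
  move=> us; apply: tsubst_id; apply/negP => /subterms_leq.
  by move: (subterms_leq us); rewrite /=; lia.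
have im u : u \in fterms f -> tsubst R S u = u -> u \in map (tsubst R S) (fterms f).
  by move=> uf <-; apply: map_f.
have imW u : u \in subterms (Wr t i v) -> u \in map (tsubst R S) (fterms f).
  move=> us; apply: im (Rs u us); apply: fterms_sub Rf _.
  by rewrite in_cons mem_cat us orbT.
have imj u : u \in subterms j -> u \in map (tsubst R S) (fterms f).
  move=> us; apply: im (Rj u us); apply: fterms_sub Rf _.
  by rewrite in_cons mem_cat us !orbT.
have sub : {subset fterms (And q (fsubst R S f)) <= map (tsubst R S) (fterms f)}.
  move=> u; rewrite /= mem_cat => /orP[|/fterms_fsubst[|[w wf' ->]]]; last exact: map_f.
    have -> : fterms q = subterms i ++ subterms j by case: defq => ->.
    rewrite mem_cat => /orP[ui|/imj//]; apply: imW.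
    by rewrite in_cons !mem_cat ui !orbT.
  case: defS => eS; rewrite {1}eS.
    by move=> uv; apply: imW; rewrite in_cons !mem_cat uv !orbT.
  rewrite in_cons mem_cat => /or3P[/eqP->|ut|/imj//].
    by apply/mapP; exists R; rewrite ?tsubst_refl ?eS.
  by apply: imW; rewrite in_cons !mem_cat ut !orbT.
have aq : atoms q = [:: Eq i j] by case: defq => ->.
split.
- by rewrite /= (well_sorted_fsubst _ RS) wf andbT; case: defq => -> /=; rewrite si sj eqxx.
- exact: light_fsubst sub (ltnW ltS) lf.
- move=> t' s' u'; rewrite /= mem_cat aq inE /= atoms_fsubst => /mapP[E Ef].
  case: (atom_shape Ef) (Ef) => [[? [? ->]]//|[t1 [s1 [t2 ->]]] Ef1 [_ -> _]].
  by rewrite size_map; apply: leqW; apply: sf Ef1.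
- apply: (@measure_redex N f _ R S [:: Eq i j]) => //.
    by move=> E; rewrite /= aq atoms_fsubst.
  by move=> E; rewrite inE => /eqP-> /=; rewrite si.
- have := fsize_fsubst_le f leS; have := fterms_size Rf.
  by case: defq => -> /=; nia.
Qed.

(** The rules other than ElimWrRd replace an atom [E] by a lighter [h], possibly under a weightless
    guard [q]; [K] collects the terms that they create. *)
Lemma simp_atom N L f g E h q (K : seq (term B)) :
  well_sorted f -> light N f -> small_indices L f -> E \in atoms f ->
  g = asubst E h f \/ g = And q (asubst E h f) ->
  well_sorted h -> dsum aweight (atoms h) < aweight E ->
  {subset fterms h <= K ++ fterms f} ->
  {in K, forall u, tweight u <= N} -> dsum tweight K <= N ->
  small_indices L.+1 h -> fsize h <= 3 * fsize E ->
  well_sorted q -> {in atoms q, forall E', aweight E' = 0} ->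
  {subset fterms q <= fterms f} -> fsize q <= (L + 5) * fsize f ->
  simp_decreases N L f g.
Proof.
move=> wf lf sf Ef defg wh hE hK KN sumK sh size_h wq q0 qf size_q.
have ag : {subset atoms g <= (atoms q ++ atoms h) ++ [seq x <- atoms f | x != E]}.
  move=> E'; have : E' \in atoms (asubst E h f) -> E' \in (atoms q ++ atoms h) ++ [seq x <- atoms f | x != E].
    by move=> /atoms_asubst; rewrite !mem_cat mem_filter andbC => -[|] ->; rewrite !orbT.
  by case: defg => -> //= H; rewrite mem_cat => /orP[|/H//]; rewrite !mem_cat => ->.
have tg : {subset fterms g <= K ++ fterms f}.
  move=> u; have : u \in fterms (asubst E h f) -> u \in K ++ fterms f.
    by move=> /fterms_asubst[/hK//|]; rewrite mem_cat orbC => ->.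
  by case: defg => -> //= H; rewrite mem_cat => /orP[/qf|/H//]; rewrite mem_cat orbC => ->.
split.
- by case: defg => -> /=; rewrite ?wq well_sorted_asubst.
- by move=> u /tg; rewrite mem_cat => /orP[/KN|/lf].
- move=> t s u /ag; rewrite !mem_cat mem_filter => /orP[/orP[/q0|]|/andP[_]].
  + by move/eqP; rewrite eqn0Ngt aweight_PEq.
  + exact: sh.
  + by move/sf/leqW.
- apply: measure_atom Ef ag tg _ sumK.
  by apply: leq_ltn_trans (dsum_cat _ _ _) _; rewrite (dsum0 q0).
- have := @fsize_asubst _ _ _ f _ size_h.
  by case: defg => -> /=; have := fsize_gt0 f; nia.
Qed.

Lemma simp_step N L f fs g :
  simp f fs -> well_sorted f -> light N f -> small_indices L f ->
  g \in fs -> simp_decreases N L f g.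
Proof.
case=> {f fs} [f t i v j Rf|f t1 j v s t2 Ef|f t1 t2 Ef a1 a2|f t s Ef|f t1 s t2 Ef w2 w1] wf lf sf.
- by rewrite !inE => /orP[]/eqP->; apply: simp_redex; auto.
- have wE := well_sorted_atom wf Ef; have [b [V [sW s2 ss]]] := well_sorted_PEq wE.
  have [|b' [V' [s1 sj sv sW']]] := sorted_Wr (t := t1) (i := j) (v := v); first by rewrite sW.
  move: sW'; rewrite sW => -[eb eV]; rewrite -{b'}eb -{V'}eV in s1 sj sv.
  have [_ leE] := atoms_atom Ef; rewrite /= in leE.
  have inf u : u \in fterms (PEq (Wr t1 j v) s t2) -> u \in fterms f.
    exact: fterms_atom_sub Ef.
  have in1 u : u \in subterms t1 -> u \in fterms f.
    by move=> u1; apply: inf; rewrite /= in_cons !mem_cat u1 !orbT.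
  have inj u : u \in subterms j -> u \in fterms f.
    by move=> u1; apply: inf; rewrite /= in_cons !mem_cat u1 !orbT.
  have inv u : u \in subterms v -> u \in fterms f.
    by move=> u1; apply: inf; rewrite /= in_cons !mem_cat u1 !orbT.
  have in2 u : u \in subterms t2 -> u \in fterms f.
    by move=> u1; apply: inf; rewrite /= in_cons !mem_cat u1 !orbT.
  have ins u : u \in flatten [seq subterms i | i <- s] -> u \in fterms f.
    by move=> u1; apply: inf; rewrite /= in_cons !mem_cat u1 !orbT.
  have tw2 : tweight t2 <= N by apply/lf/in2/subterms_refl.
  have size_q : fsize (inidx j s) <= (L + 4) * fsize f.
    rewrite fsize_inidx; have := sf _ _ _ Ef; nia.
  have wq : well_sorted (inidx j s) by apply: well_sorted_inidx sj ss.
  have q0 : {in atoms (inidx j s), forall E', aweight E' = 0}.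
    by rewrite atoms_inidx => _ /mapP[i _ ->]; rewrite /= sj.
  have qf : {subset fterms (inidx j s) <= fterms f}.
    move=> u /fterms_inidx[/inj//|[i si ui]]; apply: ins.
    by apply/flattenP; exists (subterms i) => //; apply: map_f.
  have tw_gt0 := tweight_gt0 t2; have f_gt0 := fsize_gt0 f.
  rewrite !inE => /orP[] /eqP->.
    apply: (simp_atom (K := [::]) wf lf sf Ef _ _ _ _ _ _ _ _ wq q0 qf); first by right.
    + by rewrite /= s1 s2 eqxx; apply/allP => i /ss->.
    + by rewrite dsum_seq1 /=; do ?[case: ifP => _]; nia.
    + by move=> u; rewrite /= !mem_cat => /or3P[/in1|/ins|/in2].
    + by [].
    + by rewrite dsum_nil.
    + by move=> t s' u; rewrite inE => /eqP[_ -> _]; apply: leqW (sf _ _ _ Ef).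
    + by rewrite /=; lia.
    + by nia.
  (* The only term created is [Rd t2 j], which weighs the same as [t2]. *)
  apply: (simp_atom (q := Not (inidx j s)) (K := [:: Rd t2 j]) wf lf sf Ef _ _ _ _ _ _ _ _ wq q0 qf); first by right.
  + rewrite /= s1 s2 sv sj !eqxx /= andbT.
    by apply/allP => i; rewrite mem_rcons inE => /orP[/eqP->|/ss->]; rewrite ?sj.
  (* With x, y and z the weights of [t1], [v] and [t2], the new equations weigh at most 6xz + 2 and
     6yz + 3; the old one weighs at least 6(1 + x + y)z, which is more because 6z > 5. *)
  + apply: leq_ltn_trans (dsum_cons _ _ _) _; rewrite dsum_seq1 /=.
    by do ?[case: ifP => _]; nia.
  + move=> u; rewrite /= map_rcons flatten_rcons !(mem_cat, in_cons).
    have i1 := in1 u; have i2 := in2 u; have ii := ins u; have ij := inj u; have iv := inv u.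
    by move=> H; apply/orP; move: H; repeat case/orP; auto.
  + by move=> u; rewrite inE => /eqP->.
  + by rewrite dsum_seq1.
  + move=> t s' u; rewrite !inE orbF => /eqP[_ -> _].
    by rewrite size_rcons ltnS; apply: sf Ef.
  + by rewrite /= map_rcons sumn_rcons; lia.
  + by rewrite /=; nia.
- have wE := well_sorted_atom wf Ef.
  case e1: (sort_of t1) a1 wE => [[//|b V]|//] _; rewrite /= e1 /= => /eqP e2.
  rewrite inE => /eqP->.
  apply: (simp_atom (q := Top) (K := [::]) wf lf sf Ef) => //; first by left.
  + by rewrite /= e1 -e2 eqxx.
  (* The summand 3 of an array equality exceeds the summand of a partial equality, which is at most
     2. *)
  + by rewrite dsum_seq1 /= e1 /=; do ?[case: ifP => _]; nia.
  + by move=> u ut; apply: fterms_atom_sub Ef _.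
  + by rewrite dsum_nil.
  + by move=> t s' u; rewrite inE => /eqP[_ -> _].
  + by rewrite /=; nia.
  + by have := fsize_gt0 f; rewrite /=; nia.
- rewrite inE => /eqP->.
  apply: (simp_atom (q := Top) (K := [::]) wf lf sf Ef) => //; first by left.
  + by [].
  + by rewrite /= dsum_nil aweight_PEq.
  + by [].
  + by rewrite dsum_nil.
  + by [].
  + by [].
  + by have := fsize_gt0 f; rewrite /=; nia.
- have wE := well_sorted_atom wf Ef; have [b [V [e1 e2 ss]]] := well_sorted_PEq wE.
  rewrite inE => /eqP->.
  apply: (simp_atom (q := Top) (K := [::]) wf lf sf Ef) => //; first by left.
  + by rewrite /= e1 e2 eqxx; apply/allP => i /ss->.
  + by rewrite dsum_seq1 /= w2 (negbTE w1); nia.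
  + move=> u ut; apply: (fterms_atom_sub Ef _); move: ut; rewrite /= !mem_cat.
    by move=> /or3P[] ->; rewrite ?orbT.
  + by rewrite dsum_nil.
  + by move=> t s' u; rewrite inE => /eqP[_ -> _]; apply: leqW (sf _ _ _ Ef).
  + by rewrite /=; nia.
  + by have := fsize_gt0 f; rewrite /=; nia.
Qed.

End Simplification.

(** * Invariants of the later steps *)

Section LaterSteps.
Variables (B : eqType) (a : var B).
Implicit Types (t u v R S : term B) (f g h E c e : form B) (x s : var B).
Implicit Types (dn : seq (term B)) (ex : seq (var B)) (d : delta B).

Definition on E : bool := isSome (peq_on a E).

(** The shape of the atoms at a fixed point of the first step: apart from being read, [a] may only
    be one of the two sides of a partial equality. *)
Definition normal_atom E : bool :=
  match E with
  | Eq t u => tonly_read a t && tonly_read a u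
  | PEq l s r =>
      [&& all (tonly_read a) s, (l == Var a) || tonly_read a l,
          (r == Var a) || tonly_read a r & ~~ ((l == Var a) && (r == Var a))]
  | _ => true
  end.

Definition normal f : Prop := {in atoms f, forall E, normal_atom E}.

Definition on_literal c : bool := on c || (if c is Not g then on g else false).

Lemma tonly_read_subterm t u :
  tonly_read a t -> u \in subterms t -> u = Var a \/ tonly_read a u.
Proof.
elim: t => [x|t1 IH1 t2 IH2|t1 IH1 t2 IH2 t3 IH3] /= rt; rewrite in_cons => /orP[/eqP->|] //; auto.
- case/andP: rt => r1 r2; rewrite mem_cat => /orP[|/(IH2 r2)//].
  case: t1 r1 IH1 => [y _ _|t1 t1' r1 IH1|t1 t1' t1'' r1 IH1]; try exact: IH1.
  rewrite inE => /eqP-> /=.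
  by case: (eqVneq y a) => [->|ya]; auto.
- case/and3P: rt => r1 r2 r3; rewrite !mem_cat.
  by move=> /or3P[/(IH1 r1)|/(IH2 r2)|/(IH3 r3)].
Qed.

(** Turns the absence of reads over [a] into the absence of [a], and supplies the inner read in the
    search for an innermost one. *)
Lemma tonly_read_occurs t :
  tonly_read a t -> toccurs a t -> exists t', Rd (Var a) t' \in subterms t.
Proof.
rewrite /toccurs.
elim: t => [x|t1 IH1 t2 IH2|t1 IH1 t2 IH2 t3 IH3] /= rt; rewrite in_cons => /orP[/eqP e|] //.
- by case: e rt => ->; rewrite eqxx.
- case/andP: rt => r1 r2; rewrite mem_cat => /orP[a1|/(IH2 r2)[t' t'2]]; last first.
    by exists t'; rewrite in_cons mem_cat t'2 !orbT.
  case: t1 r1 IH1 a1 => [y _ _|t1 t1' r1 IH1|t1 t1' t1'' r1 IH1].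
  + by rewrite inE => /eqP[<-]; exists t2; rewrite mem_head.
  + by move=> /(IH1 r1)[t' t'1]; exists t'; rewrite in_cons mem_cat t'1 !orbT.
  + by move=> /(IH1 r1)[t' t'1]; exists t'; rewrite in_cons mem_cat t'1 !orbT.
- case/and3P: rt => r1 r2 r3; rewrite !mem_cat.
  by move=> /or3P[/(IH1 r1)|/(IH2 r2)|/(IH3 r3)] [t' t't]; exists t';
     rewrite in_cons !mem_cat t't !orbT.
Qed.

Lemma free_tonly_read t : ~~ toccurs a t -> tonly_read a t.
Proof.
rewrite /toccurs.
elim: t => [x|t1 IH1 t2 IH2|t1 IH1 t2 IH2 t3 IH3] /=; rewrite in_cons negb_or.
- by case/andP => ax _; apply: contra ax => /eqP->.
- rewrite /= mem_cat negb_or => /andP[/IH1 r1 /IH2->]; rewrite andbT.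
  by case: (t1) r1.
- by rewrite /= !mem_cat !negb_or => /and3P[/IH1-> /IH2-> /IH3->].
Qed.

Lemma free_only_read f : ~~ occurs a f -> only_read a f.
Proof.
rewrite /occurs.
elim: f => //= [t u|t s u|f IHf g IHg|f IHf g IHg|f IHf g IHg].
- by rewrite mem_cat negb_or => /andP[t_ u_]; rewrite !free_tonly_read.
- rewrite !mem_cat !negb_or => /and3P[t_ s_ u_]; rewrite !free_tonly_read //= andbT.
  apply/allP => i si; apply: free_tonly_read; apply: contra s_ => ai.
  by apply/flattenP; exists (subterms i); rewrite ?map_f.
all: by rewrite mem_cat negb_or => /andP[/IHf-> /IHg->].
Qed.

Lemma normal_fterm f u : normal f -> u \in fterms f -> u = Var a \/ tonly_read a u.
Proof.
move=> nf /fterms_atoms[E Ef uE]; have := nf E Ef.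
case: (atom_shape Ef) uE => [[t [r ->]]|[t [s [r ->]]]] /=.
  rewrite mem_cat => + /andP[rt rr].
  by move=> /orP[/(tonly_read_subterm rt)|/(tonly_read_subterm rr)].
rewrite !mem_cat => + /and4P[/allP rs ht hr _].
have side w : (w == Var a) || tonly_read a w -> u \in subterms w -> u = Var a \/ tonly_read a u.
  by case/orP => [/eqP->|rw]; [rewrite inE => /eqP; left|exact: tonly_read_subterm].
move=> /or3P[/(side _ ht)//|/flattenP[_ /mapP[i /rs ri ->]]|/(side _ hr)//].
exact: tonly_read_subterm.
Qed.

Lemma normal_index f t : normal f -> Rd (Var a) t \in fterms f -> tonly_read a t.
Proof. by move=> nf /(normal_fterm nf)[|]. Qed.

(** In a normal atom, [a] sits inside a read over [a] or is a side of a partial equality on [a];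
    both are excluded here. *)
Lemma free_occurs f : normal f -> {in atoms f, forall E, ~~ on E} ->
  (forall t, Rd (Var a) t \notin fterms f) -> ~~ occurs a f.
Proof.
move=> nf noton noread; apply/negP => /fterms_atoms[E Ef aE].
have := nf E Ef; have := noton E Ef.
have noread' u t : {subset subterms u <= fterms E} -> Rd (Var a) t \notin subterms u.
  by move=> sub; apply: contra (noread t) => /sub; apply: fterms_atom_sub.
have free u : {subset subterms u <= fterms E} -> tonly_read a u -> Var a \notin subterms u.
  move=> sub ru; apply/negP => /(tonly_read_occurs ru)[t].
  by rewrite (negbTE (noread' u t sub)).
case: (atom_shape Ef) aE free => [[t [r ->]]|[t [s [r ->]]]] aE free /=.
  move=> _ /andP[/free rt /free rr]; move: aE; rewrite /= mem_cat.
  by rewrite (negbTE (rt _)) ?(negbTE (rr _)) // => v vt; rewrite mem_cat vt ?orbT.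
rewrite /on /=; case: eqP => // _; case: eqP => // _ _ /and4P[/allP rs /= rt rr _].
move: aE; rewrite !mem_cat (negbTE (free _ _ rt)) ?(negbTE (free _ _ rr)) /= ?orbF.
- move=> /flattenP[_ /mapP[i si ->]]; apply/negP; apply: free (rs i si) => v vi.
  rewrite !mem_cat; apply/or3P/Or32.
  by apply/flattenP; exists (subterms i); rewrite ?map_f.
- by move=> v vt; rewrite !mem_cat vt !orbT.
- by move=> v vt; rewrite !mem_cat vt.
Qed.

(** The index terms must be free of [a] as well, since they are copied into the iterated write that
    replaces [a]. *)
Definition free_equation e : Prop :=
  exists js t, [/\ peq_on a e = Some (js, t), ~~ toccurs a t & ~~ has (toccurs a) js].

Lemma free_on e : normal_atom e -> on e ->
  (forall t, Rd (Var a) t \notin fterms e) -> free_equation e.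
Proof.
case: e => //= l js r + + noread.
have free u : {subset subterms u <= fterms (PEq l js r)} -> tonly_read a u -> ~~ toccurs a u.
  move=> sub ru; apply/negP => /(tonly_read_occurs ru)[t /sub].
  by rewrite (negbTE (noread t)).
have free_is : all (tonly_read a) js -> ~~ has (toccurs a) js.
  move=> /allP ris; apply/hasPn => i jsi; apply: free (ris i jsi) => v vi.
  rewrite !mem_cat; apply/or3P/Or32.
  by apply/flattenP; exists (subterms i); rewrite ?map_f.
have subl : {subset subterms l <= fterms (PEq l js r)}.
  by move=> v vt; rewrite !mem_cat vt.
have subr : {subset subterms r <= fterms (PEq l js r)}.
  by move=> v vt; rewrite !mem_cat vt !orbT.
rewrite /free_equation /on /= => /and4P[/free_is fis].
case: (l == Var a) => /= [_|hl].
  by move=> hr nr _; exists js, r; split=> //; apply: free => //; rewrite (negbTE nr) in hr.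
by case: (r == Var a) => //= _ _ _; exists js, l; split=> //; apply: free.
Qed.

Lemma Var_subst_Rd t i s u : s != a ->
  (tsubst (Rd t i) (Var s) u == Var a) = (u == Var a).
Proof.
by move=> sa; case: u => //= *; case: ifP => // _; apply/eqP => -[/eqP]; rewrite (negbTE sa).
Qed.

Lemma tonly_read_tsubst t i s u : s != a -> tonly_read a u ->
  tonly_read a (tsubst (Rd t i) (Var s) u).
Proof.
move=> sa; elim: u => [x|u1 IH1 u2 IH2|u1 IH1 u2 IH2 u3 IH3] //=.
  case: ifP => //= _ /andP[r1 /IH2->]; rewrite andbT.
  case: u1 r1 IH1 => [//|u1 u1' r1 IH1|u1 u1' u1'' r1 IH1]; have := IH1 r1;
    by case: (tsubst _ _ _).
by case/and3P=> /IH1-> /IH2-> /IH3->.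
Qed.

Lemma normal_atom_fsubst t i s E : s != a -> normal_atom E ->
  normal_atom (fsubst (Rd t i) (Var s) E).
Proof.
move=> sa; case: E => //= [l r|l js r].
  by case/andP=> *; rewrite !tonly_read_tsubst.
rewrite !Var_subst_Rd // => /and4P[ris hl hr ->]; rewrite andbT; apply/and3P; split.
- by rewrite all_map; apply: sub_all ris => u; apply: tonly_read_tsubst.
- by case/orP: hl => [->//|hl]; rewrite tonly_read_tsubst ?orbT.
- by case/orP: hr => [->//|hr]; rewrite tonly_read_tsubst ?orbT.
Qed.

Lemma on_fsubst t i s E : s != a -> on (fsubst (Rd t i) (Var s) E) = on E.
Proof.
move=> sa; case: E => //= l js r; rewrite /on /= !Var_subst_Rd //.
by case: ifP => //; case: ifP.
Qed.

Lemma on_literal_fsubst t i s c : s != a ->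
  on_literal (fsubst (Rd t i) (Var s) c) = on_literal c.
Proof.
move=> sa; rewrite /on_literal on_fsubst //.
by case: c => //= g; rewrite on_fsubst.
Qed.

Lemma free_noread t u : ~~ toccurs a t -> Rd (Var a) u \notin subterms t.
Proof.
apply: contra => /subterms_trans; apply.
by rewrite in_cons mem_cat subterms_refl orbT.
Qed.

Lemma free_fsubst S f : ~~ toccurs a S -> ~~ occurs a (fsubst (Var a) S f).
Proof.
move=> aS; apply/negP => /fterms_fsubst[|[v _]]; first exact/negP.
case: v => //= x; case: eqP => [_ e|xa [ax]]; last by rewrite ax in xa.
by case/negP: aS; rewrite -e /toccurs mem_head.
Qed.

Lemma toccurs_wrs t js vs : ~~ toccurs a t -> ~~ has (toccurs a) js ->
  a \notin vs -> ~~ toccurs a (wrs t js vs).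
Proof.
rewrite /wrs; elim: js t vs => [|i js IH] t [|v vs] //= at_.
rewrite negb_or inE negb_or => /andP[ai ais] /andP[av avs]; apply: IH => //.
move: at_ ai; rewrite /toccurs /= in_cons !mem_cat !inE /= => /negbTE-> /negbTE-> /=.
by apply: contra av => /eqP[->].
Qed.

Lemma tsize_wrs t js vs :
  tsize (wrs t js vs) <= tsize t + sumn (map (@Defs.tsize B) js) + 2 * size js.
Proof.
rewrite /wrs; elim: js t vs => [|i js IH] t [|v vs] //=; try lia.
by have := IH (Wr t i (Var v)) vs; rewrite /=; lia.
Qed.

Lemma exists_fresh n (srt : sortT B) ex f :
  exists vs : seq (var B), [/\ size vs = n, uniq vs, all (fun x : var B => x.2 == srt) vs
                             & all (fresh a ex f) vs].
Proof.
pose used := a :: ex ++ pmap (fun t => if t is Var x then Some x else None) (fterms f).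
pose m := (sumn [seq x.1 | x <- used]).+1.
have small x : x \in used -> x.1 < m.
  rewrite /m; elim: (used) => //= y l IHl; rewrite inE => /orP[/eqP->|/IHl]; lia.
exists [seq (m + i, srt) | i <- iota 0 n]; split.
- by rewrite size_map size_iota.
- by rewrite map_inj_uniq ?iota_uniq // => i j [/addnI].
- by rewrite all_map; apply/allP => i _ /=.
- apply/allP => _ /mapP[i _ ->].
  have : (m + i, srt) \notin used by apply/negP => /small /=; lia.
  rewrite inE mem_cat !negb_or => /and3P[h1 h2 h3]; rewrite /fresh h1 h2 /=.
  apply: contra h3 => h3; rewrite mem_pmap; apply/mapP.
  by exists (Var (m + i, srt)).
Qed.

(** Every exception would enable a rule: a read of a write term enables ElimWrRd, an equality
    between arrays PartialEq, a write term as a side of a partial equality ElimWrEq or Symm, and [a]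
    on both sides TrivEq. By its sort, an index is neither a write term nor [a] itself. *)
Lemma fixpoint_normal f I V : a.2 = Arr I V -> well_sorted f ->
  ~ (exists fs, simp f fs) -> normal f.
Proof.
move=> sa wf nosimp.
have nored t i v j : Rd (Wr t i v) j \notin fterms f.
  by apply/negP => H; apply: nosimp; eexists; apply: ElimWrRd H.
have basic i b : sort_of i = Some (Basic b) -> ~~ is_wr i && (i != Var a).
  case: i => [x|//|t i v] /= si; last first.
    by have [|? [? [_ _ _ /=]]] := @sorted_Wr B t i v; rewrite /= si.
  by apply/eqP => -[e]; rewrite e sa in si.
have reads t : {subset subterms t <= fterms f} -> sort_of t != None ->
    ~~ is_wr t && (t != Var a) -> tonly_read a t.
  elim: t => [x|t IHt i IHi|//] sub st ok /=.
    by apply/eqP => e; rewrite e eqxx andbF in ok.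
  have [b [W [s1 s2 _]]] := sorted_Rd st; apply/andP; split; last first.
    apply: IHi (basic _ _ s2); last by rewrite s2.
    by move=> u ut; apply: sub; rewrite in_cons mem_cat ut !orbT.
  case: t s1 IHt sub st ok => // [t' i'|t' i' v'] s1 IHt sub _ _.
    apply: IHt; rewrite ?s1 //.
    by move=> u ut; apply: sub; rewrite in_cons mem_cat ut orbT.
  by move: (nored t' i' v' i); rewrite sub ?subterms_refl.
move=> E Ef; have wE := well_sorted_atom wf Ef.
have subE u : {subset subterms u <= fterms E} -> {subset subterms u <= fterms f}.
  by move=> sub v vu; apply: fterms_atom_sub Ef (sub v vu).
case: (atom_shape Ef) => [[t [u e]]|[l [s [r e]]]].
  move: wE; rewrite e /= => /andP[st /eqP su].
  have [b sb] : exists b, sort_of t = Some (Basic b).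
    case et: (sort_of t) st => [[b|b V']|//] _; first by exists b.
    case: nosimp; eexists; apply: (PartialEq (t1 := t) (t2 := u)); first by rewrite -e.
      by rewrite et.
    by rewrite -su et.
  rewrite !reads -?su ?sb // ?(basic _ b) -?su //; apply: subE => v vu;
    by rewrite e /= mem_cat vu ?orbT.
rewrite e in wE; have [b [V' [sl sr ss]]] := well_sorted_PEq wE.
have nl : ~~ is_wr l.
  case: l e {wE sl} => // t i v e; case: nosimp; eexists; apply: (@ElimWrEq _ f t i v s r).
  by rewrite -e.
have nr : ~~ is_wr r.
  apply/negP => wr_r; case: nosimp; eexists; apply: (@Symm _ f l s r) => //.
  by rewrite -e.
have side u : ~~ is_wr u -> {subset subterms u <= fterms E} -> sort_of u != None ->
    (u == Var a) || tonly_read a u.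
  move=> nu su ssu; case: eqP => //= /eqP ua; apply: reads; rewrite ?nu //.
  exact: subE.
rewrite e /=; apply/and4P; split.
- apply/allP => i si; apply: reads (basic _ _ (ss i si)); last by rewrite (ss i si).
  apply: subE => v vi; rewrite e /= !mem_cat; apply/or3P/Or32.
  by apply/flattenP; exists (subterms i); rewrite ?map_f.
- by apply: side; rewrite ?sl // e => v vl; rewrite !mem_cat vl.
- by apply: side; rewrite ?sr // e => v vl; rewrite !mem_cat vl !orbT.
- apply/negP => /andP[/eqP el /eqP er]; case: nosimp; eexists; apply: (@TrivEq _ f (Var a) s).
  by rewrite -{1}el -er -e.
Qed.

(** * Invariants of the successive stages and their preservation *)

Lemma occurs_tsubst R S u : R \in subterms u -> S \in subterms (tsubst R S u).
Proof.
elim: u => [x|u1 IH1 u2 IH2|u1 IH1 u2 IH2 u3 IH3]; rewrite in_cons eq_sym /=;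
  case: eqP => _; rewrite ?subterms_refl //= in_cons.
- by rewrite !mem_cat => /orP[/IH1->|/IH2->]; rewrite !orbT.
- by rewrite !mem_cat => /or3P[/IH1->|/IH2->|/IH3->]; rewrite !orbT.
Qed.

(** A treated partial equality survives only as a conjunct, possibly negated. Hence, when all are
    treated, no other conjunct contains a partial equality on [a]. *)
Definition inv_split (dn : seq (form B)) f : Prop :=
  normal f /\ {in conjuncts f, forall c, on_literal c \/ {in atoms c, forall E, E \notin dn}}.

Definition read_conjunct dn c : Prop :=
  exists q, [/\ c = read_eq a q, q.1 != a, ~~ toccurs a q.2 & Rd (Var a) q.2 \in dn].

Definition other_conjunct dn c : Prop :=
  (on_literal c \/ {in atoms c, forall E, ~~ on E}) /\ {in dn, forall u, u \notin fterms c}.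

(** A factored read survives only in its defining equation. The last clause records that this
    equation is still present, so that later fresh variables avoid the read, and that the index of
    the read is free of [a]. *)
Definition inv_factor dn f : Prop :=
  [/\ normal f,
      {in conjuncts f, forall c, read_conjunct dn c \/ other_conjunct dn c}
    & {in dn, forall u, exists q,
         [/\ u = Rd (Var a) q.2, ~~ toccurs a q.2 & read_eq a q \in conjuncts f]}].

Definition inv_delta d : Prop :=
  [/\ {in eqs d ++ diseqs d, forall e, free_equation e},
      {in rest d, forall c, ~~ occurs a c}
    & {in reads d, forall q, q.1 != a /\ ~~ toccurs a q.2}].

Definition inv_task (t : task B) : Prop :=
  match t with
  | TSimp f => well_sorted f
  | TSplit dn f => inv_split dn f
  | TFactor dn _ f => inv_factor dn f
  | TElimEq _ d => inv_delta d
  | TElimDiseq _ d => inv_delta d /\ eqs d = [::]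
  | TAckermann _ d => [/\ inv_delta d, eqs d = [::] & diseqs d = [::]]
  | TReturn _ _ => True
  end.

Lemma conjuncts_asubst E h f : conjuncts h = [:: h] ->
  conjuncts (asubst E h f) = map (asubst E h) (conjuncts f).
Proof.
move=> ch; elim: f => //= [t u|t s u|f -> g ->]; last by rewrite map_cat.
all: by case: ifP => // _; rewrite ch.
Qed.

(** A conjunct that is [e] or its negation becomes [h] or [Not h], without atoms; the other literals
    on [a] are untouched; every remaining conjunct loses its occurrences of [e]. *)
Lemma inv_split_step (dn : seq (form B)) f e h l :
  inv_split dn f -> e \in atoms f -> on e -> h = Top \/ h = Bot ->
  l = e \/ l = Not e -> inv_split (e :: dn) (And l (asubst e h f)).
Proof.
move=> [nf cf] ef one defh defl.
have ah : atoms h = [::] by case: defh => ->.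
have ch : conjuncts h = [:: h] by case: defh => ->.
have [ae _] := atoms_atom ef.
have al : atoms l = [:: e] by case: defl => ->.
have cl : conjuncts l = [:: l].
  by case: defl => -> //; case: (atom_shape ef) => [[? [? ->]]|[? [? [? ->]]]].
split=> [E|c] /=.
  rewrite mem_cat al inE => /orP[/eqP->|/atoms_asubst]; first exact: nf.
  by rewrite ah => -[//|/andP[/nf]].
rewrite cl inE (conjuncts_asubst _ _ ch) => /orP[/eqP->|/mapP[c0 c0f ->]].
  by left; case: defl => ->; rewrite /on_literal one ?orbT.
have free_h : {in atoms h, forall E, E \notin e :: dn} by rewrite ah.
case: (cf c0 c0f) => [lc|c0dn]; last first.
  right=> E /atoms_asubst[|/andP[Ec0 Ee]]; first by rewrite ah.
  by rewrite inE negb_or Ee c0dn.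
case: c0 lc {c0f} => //= [l1 s1 r1|g] lc; first by case: ifP; auto.
case: g lc => //= l1 s1 r1 lc; case: ifP => [_|_]; last by left.
by right=> E /=; apply: free_h.
Qed.

Lemma inv_split_done (dn : seq (form B)) f : inv_split dn f ->
  {in atoms f, forall e, on e -> e \in dn} -> inv_factor [::] f.
Proof.
move=> [nf cf] done; split=> // c c_f; right; split=> //.
case: (cf c c_f) => [|cdn]; [by left|right=> E Ec].
apply: contra (cdn E Ec); apply: done.
by apply/atoms_conjuncts; exists c.
Qed.

(** Reads factored earlier have indices free of [a], so they do not contain the read replaced now.
    Conversely, a term changed by the substitution contains the fresh [s], so no factored read can
    reappear. *)
Lemma inv_factor_step dn f t s : inv_factor dn f ->
  Rd (Var a) t \in fterms f -> Rd (Var a) t \notin dn -> ~~ toccurs a t ->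
  s != a -> ~~ occurs s f ->
  inv_factor (Rd (Var a) t :: dn)
    (And (fsubst (Rd (Var a) t) (Var s) f) (Eq (Var s) (Rd (Var a) t))).
Proof.
set R := Rd (Var a) t => -[nf cf dnf] Rf Rdn at_ sa sf.
have dn_f u : u \in dn -> u \in fterms f.
  move=> /dnf[q [-> _ qf]]; apply/fterms_conjuncts; exists (read_eq a q) => //.
  by rewrite /= in_cons orbC mem_head.
have keep q : ~~ toccurs a q.2 -> Rd (Var a) q.2 \in dn ->
    fsubst R (Var s) (read_eq a q) = read_eq a q.
  move=> aq qdn; congr Eq; apply: tsubst_id.
  rewrite in_cons mem_cat (negbTE (free_noread _ aq)) !orbF.
  by apply: contra Rdn => /eqP->.
split.
- move=> E; rewrite /= mem_cat atoms_fsubst => /orP[/mapP[E' E'f ->]|].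
    by apply: normal_atom_fsubst => //; apply: nf.
  by rewrite inE => /eqP-> /=; rewrite sa free_tonly_read.
- move=> c; rewrite /= mem_cat conjuncts_fsubst => /orP[/mapP[c0 c0f ->]|]; last first.
    by rewrite inE => /eqP->; left; exists (s, t); rewrite mem_head.
  case: (cf c0 c0f) => [[q [-> qa aq qdn]]|[lc c0dn]].
    by left; exists q; rewrite keep // inE qdn orbT.
  right; split.
    case: lc => [lc|noton]; [by left; rewrite on_literal_fsubst|right=> E].
    by rewrite atoms_fsubst => /mapP[E' /noton nE' ->]; rewrite on_fsubst.
  move=> u udn; have uf : u \in fterms f by move: udn; rewrite inE => /orP[/eqP->|/dn_f].
  have u_s : Var s \notin subterms u by apply: contra sf; apply: fterms_sub uf.
  apply/negP => /fterms_fsubst[|[v vc0 def_u]].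
    by rewrite inE => /eqP e; rewrite e mem_head in u_s.
  have Rv : R \notin subterms v.
    by apply: contra u_s => /(occurs_tsubst (Var s)); rewrite -def_u.
  rewrite (tsubst_id _ Rv) in def_u; move: udn; rewrite inE => /orP[/eqP e|/c0dn].
    by rewrite -def_u e subterms_refl in Rv.
  by rewrite def_u vc0.
- move=> u; rewrite inE => /orP[/eqP->|/[dup] udn /dnf[q [e aq qf]]].
    by exists (s, t); split=> //; rewrite /= mem_cat mem_head orbT.
  exists q; split=> //; rewrite /= mem_cat conjuncts_fsubst.
  by rewrite -(keep q) -?e // map_f.
Qed.

(** Once all reads are factored, reads over [a] occur only in their defining equations. Any other
    conjunct is a literal on [a] whose remaining parts are free of [a], or does not contain [a] at
    all; as [rest d] holds no lifted literal, only the last case is left for it. *)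
Lemma inv_lift dn f d : inv_factor dn f ->
  (forall t, Rd (Var a) t \in fterms f -> Rd (Var a) t \in dn) ->
  perm_eq (conjuncts f) (delta_conjuncts a d) ->
  all on (eqs d) -> all on (diseqs d) -> ~~ has (lifted_literal a) (rest d) ->
  inv_delta d.
Proof.
move=> [nf cf dnf] alldn pe oneqs ondis norest.
have mem c : c \in delta_conjuncts a d -> c \in conjuncts f by rewrite (perm_mem pe).
have ncf c : c \in conjuncts f -> normal c.
  by move=> c_f E Ec; apply: nf; apply/atoms_conjuncts; exists c.
have noread c : c \in conjuncts f -> other_conjunct dn c ->
    forall t, Rd (Var a) t \notin fterms c.
  move=> c_f [_ cdn] t; apply/negP => tc.
  have tf : Rd (Var a) t \in fterms f by apply/fterms_conjuncts; exists c.
  by have := cdn _ (alldn t tf); rewrite tc.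
have on_mem e : on e -> e \in atoms e by case: e => // *; rewrite mem_head.
split.
- move=> e; rewrite mem_cat => /orP[eE|eD].
    have one := allP oneqs e eE.
    have ec : e \in conjuncts f by apply: mem; rewrite /delta_conjuncts !mem_cat eE !orbT.
    case: (cf e ec) => [[q [eq _ _ _]]|oc]; first by rewrite eq in one.
    by apply: free_on => //; [apply: ncf ec _ (on_mem _ one)|apply: noread ec oc].
  have one := allP ondis e eD.
  have ec : Not e \in conjuncts f.
    by apply: mem; rewrite /delta_conjuncts !mem_cat (map_f (@Not B) eD) !orbT.
  case: (cf _ ec) => [[q [//]]|oc].
  by apply: free_on => //; [apply: ncf ec _ (on_mem _ one)|apply: noread ec oc].
- move=> c cr; have nl := hasPn norest c cr.
  have c_f : c \in conjuncts f by apply: mem; rewrite /delta_conjuncts mem_cat cr.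
  case: (cf c c_f) => [[q [eq _ _ _]]|oc]; first by rewrite eq /= eqxx in nl.
  case: (oc) => -[lc|noton] _; last exact: free_occurs (ncf c c_f) noton (noread c c_f oc).
  by case/negP: nl; move: lc; rewrite /on_literal /on; case: (c) => //= ? ? ?; rewrite orbF.
- move=> q qr; have c_f : read_eq a q \in conjuncts f.
    by apply: mem; rewrite /delta_conjuncts !mem_cat (map_f (read_eq a) qr) !orbT.
  case: (cf _ c_f) => [[q' [[-> ->] qa aq _]]//|oc].
  by have := noread _ c_f oc q.2; rewrite /= in_cons mem_head orbT.
Qed.

Lemma exists_lift (cs : seq (form B)) : exists d,
  [/\ perm_eq cs (delta_conjuncts a d), all on (eqs d), all on (diseqs d)
    & ~~ has (lifted_literal a) (rest d)].
Proof.
elim: cs => [|c cs [[r es ds qs] [/permP pe oe od nr]]]; first by exists (Delta [::] [::] [::] [::]).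
rewrite /delta_conjuncts /= in pe oe od nr.
case lc : (lifted_literal a c); last first.
  by exists (Delta (c :: r) es ds qs); split; rewrite ?perm_cons //= ?lc //; apply/permP.
case: c lc => // [t u|l s u|g] lc.
- case: t u lc => // x [] // [] // y t /= /eqP->; rewrite -/(read_eq a (x, t)).
  exists (Delta r es ds ((x, t) :: qs)); split=> //; apply/permP => p.
  by rewrite /delta_conjuncts /= pe !(count_cat, cat_cons) /= ?count_cat; lia.
- exists (Delta r (PEq l s u :: es) ds qs); split=> //; last by rewrite /= oe andbT.
  apply/permP => p; rewrite /delta_conjuncts /= pe !(count_cat, cat_cons) /= ?count_cat; lia.
- exists (Delta r es (g :: ds) qs); split=> //; last by rewrite /= od andbT.
  apply/permP => p; rewrite /delta_conjuncts /= pe !(count_cat, cat_cons) /= ?count_cat; lia.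
Qed.

End LaterSteps.

(** * Cost of an execution *)

Section Cost.
Variables (B : eqType) (a : var B).
Implicit Types (t u v R S : term B) (f g h E c e : form B) (x s : var B).
Implicit Types (ex : seq (var B)) (d : delta B) (tk : task B) (st : state B).

Definition is_read u : bool := if u is Rd t _ then t == Var a else false.

Lemma fsize_mem_bigand c (cs : seq (form B)) : c \in cs -> fsize c <= fsize (bigand cs).
Proof. by elim: cs => //= c' cs IH; rewrite inE => /orP[/eqP->|/IH]; lia. Qed.

Lemma bigand_fsubst R S (cs : seq (form B)) :
  bigand (map (fsubst R S) cs) = fsubst R S (bigand cs).
Proof. by elim: cs => //= c cs ->. Qed.

Lemma fsize_bigand_cat (cs cs' : seq (form B)) :
  (fsize (bigand (cs ++ cs'))).+1 = fsize (bigand cs) + fsize (bigand cs').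
Proof. by rewrite !fsize_bigand map_cat sumn_cat; lia. Qed.

(** Each [q] contributes one implication per later equation, of size linear in both; the resulting
    products are absorbed by the cross terms of the square. *)
Lemma fsize_ackermann (qs : seq (var B * term B)) :
  fsize (bigand (ackermann qs)) <= (fsize (bigand (map (read_eq a) qs))) ^ 2.
Proof.
elim: qs => [//|q qs IH] /=.
set imps := map _ qs.
have : fsize (bigand imps) <= size qs * (tsize q.2 + 6) + fsize (bigand (map (read_eq a) qs)).
  by rewrite /imps; elim: (qs) => //= r rs; rewrite /read_eq /=; nia.
have : size qs <= fsize (bigand (map (read_eq a) qs)) by elim: (qs) => //= r rs; lia.
have := fsize_bigand_cat imps (ackermann qs); move: IH; rewrite /read_eq /=.
move: (fsize (bigand (map _ qs))) => x; move: (fsize _) (fsize _) (fsize _) (size _) => p q' r' k.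
rewrite !expnS !expn0 !muln1; nia.
Qed.

Lemma size_leq_sumn (js : seq (term B)) : size js <= sumn (map (@Defs.tsize B) js).
Proof. by elim: js => //= j js IH; have := tsize_gt0 j; lia. Qed.

Lemma Forall_map (T : eqType) (U : Type) (P : U -> Prop) (h : T -> U) (l : seq T) :
  {in l, forall y, P (h y)} -> List.Forall P (map h l).
Proof.
elim: l => /= [|x l IH] Pl; first exact: List.Forall_nil.
by apply: List.Forall_cons; [apply: Pl; rewrite mem_head|apply: IH => y yl; apply: Pl; rewrite inE yl orbT].
Qed.

Lemma read_tsubst t s u : s != a -> is_read (tsubst (Rd (Var a) t) (Var s) u) ->
  exists t', u = Rd (Var a) t' /\ u != Rd (Var a) t.
Proof.
move=> sa; case: u => [x|u1 u2|u1 u2 u3] //=; case: eqP => // /eqP nR.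
by rewrite /is_read Var_subst_Rd // => /eqP e; exists u2; rewrite -e.
Qed.

(** * Depth and size bounds along a branch *)

Section Bounds.
Variables (N M Z : nat).
Hypothesis Z_gt0 : 0 < Z.

(** The growth factor [L + 10] of a step of the first phase, with the length [L] of the index lists
    bounded by [M]. *)
Let Q := M + 10.

(** Reads over [a] are counted already during the case splits, which create none; the constants make
    every change of stage decrease the depth. *)
Definition depth tk : nat :=
  match tk with
  | TSimp f => measure N f + 7
  | TSplit dn f => dsum (fun e => on a e && (e \notin dn) : nat) (atoms f)
                   + dsum (fun u => is_read u : nat) (fterms f) + 6
  | TFactor dn _ f => dsum (fun u => is_read u && (u \notin dn) : nat) (fterms f) + 5
  | TElimEq _ _ => 3
  | TElimDiseq _ _ => 2
  | TAckermann _ _ => 1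
  | TReturn _ _ => 0
  end.

(* Up to FactorRd a step multiplies the size by at most [Q], and the depth
   bounds the number of remaining steps. *)
Definition bounded tk : Prop :=
  match tk with
  | TSimp f => [/\ light N f, exists2 L, small_indices L f & L + depth tk <= M
                 & task_size a tk * Q ^ depth tk <= Z]
  | TSplit _ _ | TFactor _ _ _ => task_size a tk * Q ^ depth tk <= Z
  | TElimEq _ _ => task_size a tk <= Z
  | TElimDiseq _ _ | TAckermann _ _ => task_size a tk <= 5 * Z ^ 2
  | TReturn _ _ => task_size a tk <= 100 * Z ^ 4
  end.

Definition good tk : Prop := inv_task a tk /\ bounded tk.

(** The growth of the size by a factor [Q] is paid for by the decrease of the exponent. *)
Lemma bound_step (x y k l : nat) : y <= Q * x -> l < k -> x * Q ^ k <= Z -> y * Q ^ l <= Z.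
Proof.
move=> le_yx lt_lk; apply: leq_trans.
apply: (@leq_trans (x * Q ^ l.+1)).
  by rewrite expnS mulnA [x * Q]mulnC leq_mul2r le_yx orbT.
by rewrite leq_mul2l leq_pexp2l ?orbT // /Q addn_gt0 orbT.
Qed.

Lemma bound_end (x k : nat) : x * Q ^ k <= Z -> x <= Z.
Proof. by apply: leq_trans; rewrite leq_pmulr // expn_gt0 /Q addn_gt0 orbT. Qed.

Lemma good_task_size tk : good tk -> task_size a tk <= 100 * Z ^ 4.
Proof.
have Z1 : Z <= Z ^ 4 by rewrite -{1}[Z]expn1 leq_pexp2l.
have Z2 : Z ^ 2 <= Z ^ 4 by rewrite leq_pexp2l.
by case: tk => [f|dn f|dn ex f|ex d|ex d|ex d|ex f] [_] //=;
  [case=> _ _|..]; try move/bound_end; lia.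
Qed.

(** [e] stays in the formula as a conjunct but now counts as treated, and replacing it by [Top] or
    [Bot] creates neither atoms nor terms. *)
Lemma depth_split (dn : seq (form B)) f e h l :
  e \in atoms f -> on a e -> e \notin dn -> h = Top \/ h = Bot ->
  l = e \/ l = Not e ->
  depth (TSplit (e :: dn) (And l (asubst e h f))) < depth (TSplit dn f).
Proof.
move=> ef one edn defh defl; rewrite /= ltn_add2r -addSn leq_add //.
  rewrite (dsum_rem _ ef) one edn add1n ltnS.
  pose rem := [seq y <- atoms f | y != e].
  apply: (@leq_trans (dsum (fun e0 => on a e0 && (e0 \notin e :: dn) : nat) (e :: rem))).
    apply: dsum_sub => E; rewrite mem_cat inE mem_filter => /orP[|/atoms_asubst].
      have [ae _] := atoms_atom ef.
      by case: defl => -> /=; rewrite ae inE => ->.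
    by case: defh => -> /= [//|]; rewrite andbC => ->; rewrite orbT.
  apply: leq_trans (dsum_cons _ _ _) _; rewrite mem_head andbF add0n.
  by apply: leq_dsum => E _; rewrite inE negb_or; case: on; case: (E != e); case: (E \in dn).
apply: dsum_sub => u; rewrite mem_cat => /orP[|/fterms_asubst[|//]].
  by move=> ul; apply: fterms_atom_sub ef _; case: defl ul => ->.
by case: defh => ->.
Qed.

Lemma good_split (dn : seq (form B)) f e h l :
  good (TSplit dn f) ->
  e \in atoms f -> on a e -> e \notin dn -> h = Top \/ h = Bot ->
  l = e \/ l = Not e ->
  good (TSplit (e :: dn) (And l (asubst e h f))).
Proof.
move=> [inv size_f] ef one edn defh defl; split; first exact: inv_split_step inv _ _ _ _.
apply: bound_step (depth_split ef one edn defh defl) size_f.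
have [_ le_e] := atoms_atom ef; have f0 := fsize_gt0 f.
have size_h : fsize h <= 1 * fsize e by have := fsize_gt0 e; case: defh => -> /=; lia.
have := @fsize_asubst _ _ _ f _ size_h.
by case: defl => -> /=; rewrite /Q; nia.
Qed.

Lemma good_factor dn ex f t s :
  good (TFactor dn ex f) -> Rd (Var a) t \in fterms f -> Rd (Var a) t \notin dn ->
  ~~ toccurs a t -> fresh a ex f s ->
  let tk := TFactor (Rd (Var a) t :: dn) (s :: ex)
              (And (fsubst (Rd (Var a) t) (Var s) f) (Eq (Var s) (Rd (Var a) t))) in
  good tk /\ depth tk < depth (TFactor dn ex f).
Proof.
move=> [inv size_f] Rf Rdn at_ /and3P[sa _ sf] tk.
set R := Rd (Var a) t in tk Rf Rdn *.
have lt_d : depth tk < depth (TFactor dn ex f).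
  rewrite /= ltn_add2r.
  pose w' u : nat := is_read u && (u \notin R :: dn).
  have sub : {subset fterms (And (fsubst R (Var s) f) (Eq (Var s) R))
               <= (Var s :: Var a :: subterms R) ++ map (tsubst R (Var s)) (fterms f)}.
    move=> u; rewrite mem_cat => /orP[/fterms_fsubst[|[v vf ->]]|].
    - by rewrite /= !in_cons => /orP[->|].
    - by rewrite mem_cat (map_f (tsubst R (Var s)) vf) orbT.
    - by rewrite /= !(in_cons, mem_cat) => /or4P[] ->; rewrite ?orbT.
  apply: leq_ltn_trans (dsum_leq_add w' sub) _.
  (* No term of the new equation counts: [s] and [a] are not reads, [R] is treated, and its index is
     free of [a]. *)
  rewrite (dsum0 (w := w')) ?add0n.
    apply: leq_ltn_trans (dsum_image (h := tsubst R (Var s)) (t := fterms f) _ _) _.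
      by move=> _ /mapP[u uf ->]; exists u.
    apply: (ltn_dsum (x := R)) => //; last first.
      change (w' (tsubst R (Var s) R) < (is_read R && (R \notin dn))).
      by rewrite tsubst_refl /R /is_read eqxx Rdn.
    (* An untreated read in the image comes from an untreated read, because the treated ones are
       fixed by the substitution. *)
    case: inv => _ _ dnf; move=> u uf; rewrite /= /w'.
    case: (boolP (is_read (tsubst R (Var s) u))) => //= ru.
    case: (boolP (tsubst R (Var s) u \in R :: dn)) => //= nu.
    have [u2 [e nR]] := read_tsubst sa ru; rewrite {1}e /is_read eqxx lt0b /=.
    apply: contra nu => udn; have [q [eq aq _]] := dnf _ udn.
    rewrite tsubst_id ?inE ?udn ?orbT // eq in_cons mem_cat (negbTE (free_noread _ aq)) orbF.
    by rewrite -eq eq_sym (negbTE nR).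
  move=> u; rewrite !in_cons /w' => /or4P[/eqP->|/eqP->|/eqP->|/orP[/eqP->|ut]] //.
    by rewrite mem_head andbF.
  case: u ut => [//|u1 u2|//] ut; rewrite /is_read; case: eqP => //= e.
  by have := free_noread u2 at_; rewrite -e ut.
split=> //; split; first exact: inv_factor_step.
apply: bound_step lt_d size_f.
have := @fsize_fsubst_le _ R (Var s) f; have := fterms_size Rf; rewrite /= /Q.
by have := fsize_gt0 f; nia.
Qed.

(** A step lengthens the index lists by at most one and lowers the depth by at least one, so the sum
    of [L] and the depth remains at most [M] along the branch. *)
Lemma good_simp f fs g : simp f fs -> good (TSimp f) -> g \in fs ->
  good (TSimp g) /\ depth (TSimp g) < depth (TSimp f).
Proof.
move=> sf [wf [lf [L smallL le_LM] size_f]] gfs.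
have [wg lg sg lt_gf size_g] := simp_step sf wf lf smallL gfs.
have lt_d : depth (TSimp g) < depth (TSimp f) by rewrite /= ltn_add2r.
split=> //; split=> //; split=> //; first by exists L.+1 => //; move: le_LM lt_d; lia.
apply: bound_step lt_d size_f; apply: leq_trans size_g _.
by rewrite leq_mul2r /Q leq_add2r (leq_trans (leq_addr _ _) le_LM) orbT.
Qed.

Lemma on_aweight E : (on a E : nat) <= aweight E.
Proof.
by case: E => // l js r; apply: leq_trans (leq_b1 _) (aweight_PEq _ _ _).
Qed.

(** Every partial equality on [a] and every read over [a] weighs at least 1, so what is left of the
    measure bounds the case splits and factored reads to come. *)
Lemma good_fixpoint I V f : a.2 = Arr I V -> ~ (exists fs, simp f fs) ->
  good (TSimp f) -> good (TSplit [::] f) /\ depth (TSplit [::] f) < depth (TSimp f).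
Proof.
move=> sa nosimp [wf [_ _ size_f]].
have lt_d : depth (TSplit [::] f) < depth (TSimp f).
  have leA : dsum (fun e => on a e && (e \notin [::]) : nat) (atoms f) <= dsum (@aweight B) (atoms f).
    by apply: leq_dsum => e _; rewrite andbT; apply: on_aweight.
  have leR : dsum (fun u => is_read u : nat) (fterms f) <= dsum (@tweight B) (fterms f).
    by apply: leq_dsum => u _; apply: leq_trans (leq_b1 _) (tweight_gt0 _).
  rewrite /= [ltnRHS]addnS ltnS leq_add2r leq_add //; exact: leq_trans leA (leq_pmull _ _).
split=> //; split; last by apply: bound_step lt_d size_f; rewrite /= /Q; nia.
by split; [apply: fixpoint_normal sa wf nosimp|move=> c _; right].
Qed.

Lemma good_lift dn ex f d : good (TFactor dn ex f) ->
  (forall t, Rd (Var a) t \in fterms f -> Rd (Var a) t \in dn) ->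
  perm_eq (conjuncts f) (delta_conjuncts a d) ->
  all (on a) (eqs d) -> all (on a) (diseqs d) -> ~~ has (lifted_literal a) (rest d) ->
  good (TElimEq ex d).
Proof.
move=> [inv size_f] alldn pe oneqs ondis nr.
split; first exact: inv_lift inv alldn pe oneqs ondis nr.
have : (size ex + delta_size a d) * Q ^ 0 <= Z.
  apply: bound_step size_f; last by rewrite /= addnS.
  rewrite /delta_size fsize_bigand -(perm_sumn (perm_map _ pe)) fsize_conjuncts.
  by rewrite /= /Q; have := fsize_gt0 f; nia.
by rewrite muln1.
Qed.

(** The iterated write has size at most [3 * fsize e], so the substituted formula has size at most
    [3 * Z ^ 2], and at most [Z] variables are quantified. The write is free of [a] because the
    indices of [e] are. *)
Lemma good_elimeq ex r es1 e es2 ds qs js t vs :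
  let d := Delta r (es1 ++ e :: es2) ds qs in
  let d' := Delta r (es1 ++ es2) ds qs in
  good (TElimEq ex d) -> peq_on a e = Some (js, t) -> ~~ toccurs a t ->
  size vs = size js -> all (fresh a ex (bigand (delta_conjuncts a d))) vs ->
  good (TElimDiseq (vs ++ ex)
    (Delta (map (fsubst (Var a) (wrs t js vs)) (delta_conjuncts a d')) [::] [::] [::])).
Proof.
move=> d d' [[freeE _ _] size_d] eqe at_ size_vs fresh_vs.
have [js' [t' []]] : free_equation a e by apply: freeE; rewrite !mem_cat mem_head orbT.
rewrite eqe => -[<- _] _ ajs; split.
  split=> //; split=> // _ /mapP[c _ ->]; apply: free_fsubst; apply: toccurs_wrs => //.
  by apply/negP => /(allP fresh_vs); rewrite /fresh eqxx.
rewrite /= /delta_size /delta_conjuncts /= !cats0 bigand_fsubst size_cat size_vs.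
rewrite /= in size_d.
have le_d' : fsize (bigand (delta_conjuncts a d')) <= delta_size a d.
  by rewrite /delta_size !fsize_bigand /delta_conjuncts /= !(map_cat, sumn_cat) /=; lia.
have le_e : fsize e <= delta_size a d.
  by apply: fsize_mem_bigand; rewrite /delta_conjuncts !mem_cat mem_head !orbT.
have le_js := size_leq_sumn js.
have [le_js' le_wrs] : size js <= fsize e /\ tsize (wrs t js vs) <= 3 * fsize e.
  have := tsize_wrs t js vs; move: eqe le_js; case: (e) => //= l s' r'.
  by case: ifP => _; [|case: ifP => // _] => -[-> ->]; lia.
have := @fsize_fsubst B (Var a) (wrs t js vs) (bigand (delta_conjuncts a d')) (3 * fsize e).
rewrite muln_gt0 fsize_gt0 => /(_ isT le_wrs); rewrite /delta_conjuncts /=.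
move: size_d le_d' le_e le_js'; rewrite /delta_conjuncts /=.
move: (fsize (fsubst _ _ _)) (fsize (bigand _)) (delta_size _ _) (fsize e) (size js) (size ex).
move=> x1 x2 x3 x4 x5 x6 h1 h2 h3 h4 h5.
have : x1 <= 3 * (Z * Z).
  apply: leq_trans h5 _; rewrite -mulnA leq_mul2l /=; apply: leq_mul; lia.
rewrite expnS expn1; nia.
Qed.

Lemma good_elimdiseq ex r ds qs :
  good (TElimDiseq ex (Delta r [::] ds qs)) -> good (TAckermann ex (Delta r [::] [::] qs)).
Proof.
move=> [[[_ freeR readR] _] size_d]; split=> //; apply: leq_trans size_d.
rewrite /= leq_add2l /delta_size !fsize_bigand /delta_conjuncts /= !map_cat !sumn_cat; lia.
Qed.

(** The square of [5 * Z ^ 2] bounds the implications; with the unchanged conjuncts and variables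
    the total remains below [100 * Z ^ 4]. *)
Lemma good_ackermann ex r qs :
  good (TAckermann ex (Delta r [::] [::] qs)) ->
  good (TReturn ex (And (bigand r) (bigand (ackermann qs)))).
Proof.
move=> [_ size_d]; split=> //; move: size_d.
rewrite /= /delta_size /delta_conjuncts /=.
have := fsize_bigand_cat r (map (read_eq a) qs); have := fsize_ackermann qs.
move: (fsize (bigand (_ ++ _))) (fsize (bigand (map _ _))) (fsize (bigand (ackermann _))).
move: (fsize (bigand r)) (fsize_gt0 (bigand r)) (size ex) => x1 x10 x2 x3 x4 x5 h1 h2 h3.
have : x5 <= (5 * Z ^ 2) ^ 2 by apply: leq_trans h1 _; rewrite leq_exp2r //; lia.
have Z2 : Z ^ 2 <= Z ^ 4 by rewrite leq_pexp2l.
have := expn_gt0 Z 4; rewrite Z_gt0 expnMn -expnM /=; lia.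
Qed.

Definition smaller tk tk' : Prop := good tk' /\ depth tk' < depth tk.

Lemma good_step I V tk tks : a.2 = Arr I V -> task_step a tk tks -> good tk ->
  List.Forall (smaller tk) tks /\ size tks <= 2.
Proof.
move=> sa; have one tk1 tk2 : smaller tk1 tk2 ->
    List.Forall (smaller tk1) [:: tk2] /\ size [:: tk2] <= 2.
  by move=> sm; split=> //; apply: List.Forall_cons => //; apply: List.Forall_nil.
case.
- move=> f fs sf gf; split; last by rewrite size_map; case: sf.
  by apply: Forall_map => g gfs; apply: good_simp sf gf gfs.
- by move=> f nosimp gf; apply/one/(good_fixpoint sa nosimp gf).
- move=> dn f e ef one_e edn gf; split=> //.
  do 2?[apply: List.Forall_cons]; try exact: List.Forall_nil.
    by split; [apply: good_split|apply: depth_split]; auto.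
  by split; [apply: good_split|apply: depth_split]; auto.
- move=> dn f done [inv size_f]; apply: one.
  have lt_d : depth (TFactor [::] [::] f) < depth (TSplit dn f).
    rewrite /= [ltnRHS]addnS ltnS leq_add2r.
    apply: leq_trans (leq_addl _ _).
    by apply: leq_dsum => u _; case: is_read.
  split=> //; split; first exact: inv_split_done inv done.
  by apply: bound_step lt_d size_f; rewrite /= /Q; nia.
- by move=> dn ex f t s Rf Rdn at_ _ fr gf; apply: one; apply: good_factor.
- move=> dn ex f d alldn pe oneqs ondis nr gf; apply: one; split; last by rewrite /= !addnS.
  exact: good_lift gf alldn pe oneqs ondis nr.
- move=> ex r es1 e es2 ds qs js t vs d d' eqe at_ size_vs _ _ fresh_vs gd; apply: one.
  by split=> //; apply: good_elimeq gd eqe at_ size_vs fresh_vs.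
- move=> ex d noeqs [inv size_d]; apply: one; split=> //; split=> //.
  by apply: leq_trans size_d _; nia.
- by move=> ex r ds qs _ _ gd; apply: one; split=> //; apply: good_elimdiseq gd.
- by move=> ex r qs _ _ gd; apply: one; split=> //; apply: good_ackermann gd.
Qed.

(** A step replaces a task of depth k + 1 by at most two of depth at most k. Base 3 makes this a
    strict decrease, as 2 * 3^k < 3^(k+1). *)
Definition potential st : nat := sumn [seq 3 ^ depth tk | tk <- st].

Lemma potential_cat st st' : potential (st ++ st') = potential st + potential st'.
Proof. by rewrite /potential map_cat sumn_cat. Qed.

Lemma good_state_step I V st st' : a.2 = Arr I V -> step a st st' ->
  List.Forall good st -> List.Forall good st' /\ potential st' < potential st.
Proof.
move=> sa [l tk tks r tkS] gst.
have [gl gr] := proj1 (List.Forall_app _ _ _) gst.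
have [gtk gr'] := proj1 (List.Forall_cons_iff _ _ _) gr.
have [sm le2] := good_step sa tkS gtk; split.
  apply/List.Forall_app; split=> //; apply/List.Forall_app; split=> //.
  by apply: List.Forall_impl sm => tk' [].
rewrite !potential_cat ltn_add2l /potential /= -/(potential tks) -/(potential r) ltn_add2r.
(* At depth 0 the step has no results at all, since they would need a smaller depth. *)
case e: (depth tk) sm => [|k] sm.
  case: sm => [|tk' tks' [_]]; first by rewrite expn_gt0.
  by rewrite e.
have : potential tks <= size tks * 3 ^ k.
  elim: sm => // tk' tks' [_]; rewrite e ltnS => le_k _.
  by rewrite /potential /= mulSn; apply: leq_add; rewrite leq_exp2l.
rewrite expnS; have := expn_gt0 3 k; nia.
Qed.

Lemma state_size_bound st : List.Forall good st ->
  state_size a st <= potential st * (100 * Z ^ 4).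
Proof.
elim=> // tk st' gtk _ IH; rewrite /state_size /potential /= mulnDl; apply: leq_add => //.
by apply: leq_trans (good_task_size gtk) _; rewrite leq_pmull // expn_gt0.
Qed.

Lemma run_bound I V st T st' : a.2 = Arr I V -> run a st T st' -> List.Forall good st ->
  List.Forall good st' /\ T <= 200 * Z ^ 4 * potential st ^ 2.
Proof.
move=> sa run_st gst.
(* Time is traded against potential: a step costs at most [200 * Z ^ 4 * potential st] and lowers
   the potential by at least 1. *)
suff [gst' [le_pot le_T]] : List.Forall good st' /\ potential st' <= potential st /\
    T + 200 * Z ^ 4 * (potential st * potential st') <= 200 * Z ^ 4 * potential st ^ 2.
  by split=> //; apply: leq_trans le_T; rewrite leq_addr.
elim: run_st => {T st'} [|T st1 st2 _ [g1 [le1 leT]] st12].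
  by rewrite add0n mulnn.
have [g2 lt2] := good_state_step sa st12 g1; split=> //.
split; first exact: leq_trans (ltnW lt2) le1.
apply: leq_trans leT; rewrite -addnA leq_add2l.
have := state_size_bound g1; have := state_size_bound g2.
move: (state_size a st1) (state_size a st2) (potential st) (Z ^ 4) le1 lt2.
move: (potential st1) (potential st2) => p1 p2 s1 s2 p z le1 lt2 h2 h1.
have h : 200 * z * (p * p2) + 200 * z * p <= 200 * z * (p * p1).
  by rewrite -mulnDr leq_mul2l; apply/orP; right; rewrite -{2}[p]muln1 -mulnDr leq_mul2l addn1 lt2 orbT.
have : p1 * (100 * z) <= p * (100 * z) by rewrite leq_mul2r le1 orbT.
have : p2 * (100 * z) <= p * (100 * z) by rewrite leq_mul2r (leq_trans (ltnW lt2) le1) orbT.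
by move: h h1 h2; lia.
Qed.

End Bounds.
End Cost.

(** * Progress *)

Section Progress.
Variables (B : eqType) (a : var B).

(** If the index [t] contains [a], it contains a smaller read over [a]. That read is untreated too:
    otherwise the conjunct containing [Rd (Var a) t] would be a defining equation, whose only read
    over [a] has an index free of [a]. *)
Lemma innermost_read dn f t :
  inv_factor a dn f -> Rd (Var a) t \in fterms f -> Rd (Var a) t \notin dn ->
  exists t', [/\ Rd (Var a) t' \in fterms f, Rd (Var a) t' \notin dn & ~~ toccurs a t'].
Proof.
move=> [nf cf _]; have [n] := ubnP (tsize t); elim: n t => // n IHn t le_tn tf tdn.
case: (boolP (toccurs a t)) => [at_|]; last by exists t.
have [t' t't] := tonly_read_occurs (normal_index nf tf) at_.
have sub_t c : Rd (Var a) t \in fterms c -> Rd (Var a) t' \in fterms c.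
  by move=> tc; apply: fterms_sub tc _; rewrite in_cons mem_cat t't !orbT.
apply: (IHn t'); [by have := subterms_leq t't; rewrite /=; lia|exact: sub_t|].
apply/negP => t'dn; have [c c_f tc] := (fterms_conjuncts _ _).1 tf.
case: (cf c c_f) => [[q [def_c qa aq qdn]]|[_ /(_ _ t'dn)]]; last by rewrite sub_t.
move: tc; rewrite def_c.
change (Rd (Var a) t \in [:: Var q.1, Rd (Var a) q.2, Var a & subterms q.2] -> False).
rewrite !in_cons => /or4P[/eqP//|/eqP[e]|/eqP//|]; first by rewrite -e at_ in aq.
exact/negP/free_noread.
Qed.

(** The invariants supply the side conditions of the rule that is due at each stage. Excluded middle
    decides whether the first step has reached a fixed point. *)
Lemma task_progress (tk : task B) : inv_task a tk ->
  (exists ex f, tk = TReturn ex f) \/ exists tks, task_step a tk tks.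
Proof.
case: tk => [f|dn f|dn ex f|ex d|ex d|ex d|ex f] /=.
- move=> _; right; case: (classic (exists fs, simp f fs)) => [[fs sf]|nosimp].
    by exists (map (@TSimp B) fs); apply: SimpRule.
  by exists [:: TSplit [::] f]; apply: SimpFixpoint.
- move=> _; right; case: (boolP (has (fun e => on a e && (e \notin dn)) (atoms f))).
    by move=> /hasP[e ef /andP[one edn]]; eexists; apply: (CaseSplitEq ef one edn).
  move=> /hasPn none; eexists; apply: (@CaseSplitEqDone _ _ dn) => e ef one.
  by have := none e ef; rewrite /on one negbK.
- move=> inv; right.
  case: (boolP (has (fun u => is_read a u && (u \notin dn)) (fterms f))).
    move=> /hasP[[//|u t|//]] uf /andP[/eqP e udn]; rewrite e in uf udn.
    have [t' [t'f t'dn at']] := innermost_read inv uf udn.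
    have [vs [+ _]] := exists_fresh a 1 (value_sort a) ex f.
    case: vs => [|s []] //= _; rewrite !andbT => /eqP sv fr.
    by eexists; apply: (FactorRd t'f t'dn at' sv fr).
  move=> /hasPn none; have [d [pe oe od nr]] := exists_lift a (conjuncts f).
  exists [:: TElimEq ex d]; apply: (LiftEqDiseqRd (dn := dn)) => // t tf.
  by have := none _ tf; rewrite /is_read eqxx negbK.
- case: d => r [|e es] ds qs [freeE _ _]; right.
    by eexists; apply: ElimEqNone.
  have [js [t [eqe at_ _]]] := freeE e (mem_head _ _).
  have [vs [size_vs uniq_vs sort_vs fresh_vs]] := exists_fresh a (size js) (value_sort a) ex
    (bigand (delta_conjuncts a (Delta r ([::] ++ e :: es) ds qs))).
  by eexists; apply: (ElimEq (es1 := [::]) eqe at_ size_vs uniq_vs sort_vs fresh_vs).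
- case: d => r es ds qs [[freeE freeR readR] /= es0]; rewrite {}es0 in freeE *.
  right; eexists; apply: ElimDiseq.
    by move=> e /freeE[js [t [eqe at_ _]]]; exists js, t.
  have: {in r ++ map (read_eq a) qs, forall c, only_read a c}.
    move=> c; rewrite mem_cat => /orP[/freeR/free_only_read//|/mapP[q /readR[qa aq] ->]].
    by rewrite /= qa free_tonly_read.
  elim: (r ++ _) => //= c cs IHcs only; rewrite only ?mem_head //= IHcs //.
  by move=> c' c's; apply: only; rewrite inE c's orbT.
- case: d => r es ds qs [[_ freeR readR] /= -> ->]; right; eexists; apply: Ackermann.
    apply/negP => /fterms_bigand[c /freeR nac]; exact/negP.
  by apply/allP => q /readR[-> ->].
- by left; exists ex, f.
Qed.

Lemma state_progress (st : state B) : List.Forall (inv_task a) st ->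
  returned st \/ exists st', step a st st'.
Proof.
elim=> [|tk st' /task_progress[[ex [f ->]]|[tks tkS]] _ IH]; first by left.
  case: IH => [ret|[st2 [l tk' tks r S]]]; first by left.
  by right; exists ((TReturn ex f :: l) ++ tks ++ r); apply: (@Step _ _ (TReturn ex f :: l)).
by right; exists ([::] ++ tks ++ st'); apply: (@Step _ _ [::]).
Qed.

End Progress.

(** * Numerical bounds for the initial state, and the conclusion *)

Lemma measure_start (B : eqType) (f : form B) :
  measure (fsize f) f <= 19 * fsize f ^ 4.
Proof.
have tw u : u \in fterms f -> tweight u <= fsize f.
  by move/fterms_size => lt_u; apply: leq_trans (tweight_tsize u) (ltnW lt_u).
have in_atom E u : E \in atoms f -> u \in fterms E -> tweight u <= fsize f.
  by move=> Ef uE; apply: tw; apply: fterms_atom_sub Ef uE.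
(* With n the size of [f], an atom weighs at most 6n^2 + 3, hence at most 9n^2. *)
have aw : {in atoms f, forall E, aweight E <= 9 * fsize f ^ 2}.
  move=> E Ef; have f0 := fsize_gt0 f.
  case: (atom_shape Ef) => [[l [r e]]|[l [js [r e]]]]; rewrite e in Ef *.
    have hl : tweight l <= fsize f by apply: in_atom Ef _; rewrite mem_cat subterms_refl.
    have hr : tweight r <= fsize f by apply: in_atom Ef _; rewrite mem_cat subterms_refl orbT.
    have := leq_mul hl hr; rewrite /= expnS expn1; case: ifP => _; nia.
  have hl : tweight l <= fsize f by apply: in_atom Ef _; rewrite !mem_cat subterms_refl.
  have hr : tweight r <= fsize f by apply: in_atom Ef _; rewrite !mem_cat subterms_refl !orbT.
  have := leq_mul hl hr; rewrite /= expnS expn1; do ?[case: ifP => _]; nia.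
have := dsum_leq_size aw; have := dsum_leq_size (w := @tweight B) tw.
have := size_atoms f; have := size_fterms f; have := fsize_gt0 f; rewrite /measure.
move: (dsum _ _) (dsum _ _) (size _) (size _) (fsize f) => A R x y n n0 hx hy hR hA.
have hA' : A <= 9 * n ^ 3.
  by apply: leq_trans hA _; rewrite mulnCA leq_mul2l /= [n ^ 3]expnS leq_mul2r hy orbT.
have hR' : R <= n ^ 2 by apply: leq_trans hR _; rewrite -mulnn leq_mul2r hx orbT.
have h34 : n ^ 3 <= n ^ 4 by rewrite leq_pexp2l.
have h24 : n ^ 2 <= n ^ 4 by rewrite leq_pexp2l.
have : n.+1 * A <= n.+1 * (9 * n ^ 3) by rewrite leq_mul2l hA' orbT.
have -> : n.+1 * (9 * n ^ 3) = 9 * n ^ 3 + 9 * n ^ 4.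
  by rewrite mulSn [n * (9 * _)]mulnCA -expnS.
lia.
Qed.

(** By [m <= 2 ^ m] every factor becomes a power of 2. The exponent is quadratic in [d] because of
    [(d + 10) ^ d], and [d] is of order n^4; this gives the exponent 8. *)
Lemma exponential_bound n d : 0 < n -> d <= 26 * n ^ 4 ->
  200 * (n * (d + 10) ^ d) ^ 4 * (3 ^ d) ^ 2 <= 2 ^ (4000 * n ^ 8 + 4000).
Proof.
move=> n0 le_d.
have le2 m : m <= 2 ^ m by apply: ltnW; apply: ltn_expl.
have h1 : (n * (d + 10) ^ d) ^ 4 <= 2 ^ (4 * n + 4 * ((d + 10) * d)).
  rewrite -mulnDr [4 * _]mulnC expnM leq_exp2r // expnD leq_mul //.
  by rewrite expnM; case: (d) => // k; rewrite leq_exp2r.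
have h2 : (3 ^ d) ^ 2 <= 2 ^ (4 * d).
  by rewrite -expnM mulnC expnM [4 * d]mulnC [_ * 4]mulnC expnM; case: (d) => // k; rewrite leq_exp2r.
apply: leq_trans (leq_mul (leq_mul (_ : 200 <= 2 ^ 8) h1) h2) _; first by [].
rewrite -!expnD leq_exp2l //.
have n4 : n <= n ^ 4 by rewrite -{1}[n]expn1 leq_pexp2l.
have -> : n ^ 8 = n ^ 4 * n ^ 4 by rewrite -expnD.
move: (n ^ 4) n4 le_d => m n4 le_d.
have m0 : 0 < m := leq_trans n0 n4.
have dd : d * d <= 26 * m * (26 * m) by apply: leq_mul.
have mm : m <= m * m by rewrite leq_pmulr.
rewrite mulnDl; nia.
Qed.

Theorem theorem2 :
  exists c k : nat,
    forall (B : eqType) (M : array_structure B)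
           (phi : form B) (a : var B) (I : B) (V : sortT B),
      well_sorted phi ->
      qfree phi ->
      a.2 = Arr I V ->
      infinite_type (dom M (Basic I)) ->
      forall (T : nat) (st : state B),
        run a (start phi) T st ->
        T <= 2 ^ (c * fsize phi ^ k + c) /\
        (returned st \/ exists st' : state B, step a st st').
Proof.
exists 4000, 8 => B _ phi a I V wphi qphi sa _ T st run_st.
(* [n] bounds the weights of the terms. The depth [d] can serve as [M] since initially there are no
   index lists, and [Z] below is the initial size times [Q ^ d]. *)
pose n := fsize phi; pose d := depth a n (TSimp phi).
have n0 : 0 < n := fsize_gt0 phi.
(* 26 is 19 from the initial measure plus the constant 7 of [TSimp] in [depth]. *)
have le_d : d <= 26 * n ^ 4.
  have := measure_start phi; rewrite /d /= -/n; have := expn_gt0 n 4; rewrite n0 /=; lia.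
pose Z := n * (d + 10) ^ d.
have Z0 : 0 < Z by rewrite muln_gt0 n0 expn_gt0 addn_gt0 orbT.
have noPEq t js u : PEq t js u \notin atoms phi.
  elim: (phi) qphi => //= [f IHf g IHg|f IHf g IHg|f IHf g IHg] /andP[/IHf nf /IHg ng];
    by rewrite mem_cat negb_or nf ng.
have good_start : List.Forall (good a n d Z) (start phi).
  apply: List.Forall_cons; last exact: List.Forall_nil.
  split=> //; split=> //; last by exists 0 => // t js u; rewrite (negbTE (noPEq t js u)).
  by move=> u /fterms_size lt_u; apply: leq_trans (tweight_tsize u) (ltnW lt_u).
have [good_st le_T] := run_bound Z0 sa run_st good_start.
split; last by apply: state_progress; apply: List.Forall_impl good_st => tk [].
apply: leq_trans le_T _; rewrite /potential /= addn0.
exact: exponential_bound.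
Qed.
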